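(* Let $\Psi$ be a uniformly hyperbolic affine flow on $B\times H$ with linear part $\Phi$, let $\mathcal{V}_1,\dots,\mathcal{V}_\ell$ be the Selgrade bundles of $\Phi$, $\mathcal{V}_i^\infty=\mathcal{V}_i\times\{0\}$, and let $\Psi^1$ be the lift of $\Psi$ to $B\times H^1$. (i) The Selgrade bundles of $\Psi^1$ are $\mathcal{V}_i^\infty$, $i\in\{1,\dots,\ell\}$, together with the central Selgrade bundle $\mathcal{V}_c^1$, which is the line bundle in $B\times H^1$ given by $$\mathcal{V}_c^1=\{(b,-r\,e(b,0),r)\in B\times H\times\mathbb{R}\mid b\in B,\ r\in\mathbb{R}\}.$$ The projection $\mathcal{M}_c^1=\mathbb{P}\mathcal{V}_c^1$ to $B\times\mathbb{P}H^1$ is a compact subset of $B\times\mathbb{P}H^{1,1}$ and coincides with the image of the chain recurrent set of $\Psi$, i.e., $$\mathcal{M}_c^1=\{(b,\mathbb{P}(x,1))\mid (b,x)\in h_{aff}(\mathcal{R})\},$$ where $\mathcal{R}=B\times\{0_H\}$ and $h_{aff}(\mathcal{R})=\{(b,-e(b,0))\mid b\in B\}$. (ii) The Morse spectra of the Selgrade bundles are $$\Sigma_{Mo}(\mathcal{V}_i^\infty;\Psi^1)=\Sigma_{Mo}(\mathcal{V}_i;\Phi)\ \text{ for } i\in\{1,\dots,\ell\},\qquad \Sigma_{Mo}(\mathcal{V}_c^1;\Psi^1)=\{0\}.$$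
   Context: Flows and chains: A flow on a metric space $X$ is a continuous map $\Phi:\mathbb{R}\times X\to X$ with $\Phi_0=\mathrm{id}$, $\Phi_{t+s}=\Phi_t\circ\Phi_s$. For $\varepsilon,T>0$ an $(\varepsilon,T)$-chain consists of $n\ge1$, $T_0,\dots,T_{n-1}\ge T$ and $x_0,x_1,\dots,x_n\in X$ with $d(\Phi_{T_i}(x_i),x_{i+1})<\varepsilon$ for $i=0,\dots,n-1$ (it goes from $x_0$ to $x_n$). A point $x$ is chain recurrent if for all $\varepsilon,T>0$ there is an $(\varepsilon,T)$-chain from $x$ to $x$; the chain recurrent set is the set of all such points. A set $Y$ is chain transitive if for all $x,y\in Y$ and all $\varepsilon,T>0$ there is an $(\varepsilon,T)$-chain from $x$ to $y$. A chain recurrent component is a maximal chain transitive set. Linear flows and Selgrade's theorem: $B$ is a compact metric space with a chain transitive flow $\theta$ and $H$ is a finite dimensional real Hilbert space. A linear flow on $B\times H$ is a flow $\Phi_t(b,x)=(\theta_tb,\varphi(t,b,x))$ with $\varphi(t,b,\cdot)$ linear. A subbundle is a closed subset of $B\times H$ intersecting each fiber in a linear subspace of constant dimension. $\mathbb{P}$ denotes the projections $H\setminus\{0\}\to\mathbb{P}H$ and $B\times(H\setminus\{0\})\to B\times\mathbb{P}H$ (for a subbundle $\mathcal{V}$, $\mathbb{P}\mathcal{V}$ is the image of its points with nonzero fiber component). $\mathbb{P}H$ has the metric $d(\mathbb{P}x,\mathbb{P}y)=\min\{\|\frac{x}{\|x\|}-\frac{y}{\|y\|}\|,\|\frac{x}{\|x\|}+\frac{y}{\|y\|}\|\}$;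 products with $B$ (also $B\times H$) have the maximum metric. $\Phi$ induces a flow $\mathbb{P}\Phi$ on $B\times\mathbb{P}H$. Selgrade's theorem: $\mathbb{P}\Phi$ has finitely many chain recurrent components $\mathcal{M}_1,\dots,\mathcal{M}_\ell$; the sets $\mathcal{V}_i=\{(b,x)\mid x\ne0\Rightarrow(b,\mathbb{P}x)\in\mathcal{M}_i\}$ are subbundles, called the Selgrade bundles, and $B\times H=\mathcal{V}_1\oplus\dots\oplus\mathcal{V}_\ell$. Morse spectrum: For an $(\varepsilon,T)$-chain $\zeta$ of $\mathbb{P}\Phi$ given by $T_0,\dots,T_{n-1}\ge T$ and $(b_0,p_0),\dots,(b_n,p_n)$, with $\tau=\sum_{i=0}^{n-1}T_i$ and $\mathbb{P}x_i=p_i$, put $\lambda(\zeta)=\frac1\tau\sum_{i=0}^{n-1}\big(\log\|\varphi(T_i,b_i,x_i)\|-\log\|x_i\|\big)$. For a Selgrade bundle (or invariant subbundle) $\mathcal{V}$, $\Sigma_{Mo}(\mathcal{V};\Phi)$ is the set of all $\lambda\in\mathbb{R}$ for which there are $\varepsilon^k\to0$, $T^k\to\infty$ and $(\varepsilon^k,T^k)$-chains $\zeta^k$ in $\mathbb{P}\mathcal{V}$ with $\lambda(\zeta^k)\to\lambda$. The same definition is used for $\Psi^1$ on $B\times H^1$. Affine flows: An affine flow on $B\times H$ is a continuous map $\Psi=(\theta,\psi)$ for which there are a linear flow $\Phi=(\theta,\varphi)$ (the linear part) and $f:B\to L^\infty(\mathbb{R},H)$ (write $f(b,s)=f(b)(s)$)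 with $f(b,t+s)=f(\theta_sb,t)$ for all $b$ and almost all $t,s$, and $\psi(t,b,x)=\varphi(t,b,x)+\int_0^t\varphi(t-s,\theta_sb,f(b,s))\,ds$. Its lift is the linear flow on $B\times H^1$, $H^1=H\times\mathbb{R}$ (product Hilbert norm), $\Psi^1_t(b,x,r)=(\theta_tb,\varphi(t,b,x)+r\int_0^t\varphi(t-s,\theta_sb,f(b,s))\,ds,r)$. $\mathbb{P}H^{1,1}=\{\mathbb{P}(x,r)\mid x\in H,r\ne0\}$. There is a unique Selgrade bundle of $\Psi^1$ that intersects $B\times H\times(\mathbb{R}\setminus\{0\})$, called the central Selgrade bundle $\mathcal{V}_c^1$. $\Psi$ is uniformly hyperbolic if there is a decomposition $B\times H=\mathcal{V}^1\oplus\mathcal{V}^2$ into $\Phi$-invariant subbundles such that (i) the restrictions $\Phi^i_t(b,x)=(\theta_tb,\varphi^i(t,b,x))$ of $\Phi$ to $\mathcal{V}^i$ satisfy, for constants $\alpha,K>0$ and all $b\in B$, $\|\Phi^1_t(b,\cdot)\|\le Ke^{-\alpha t}$ for $t\ge0$ and $\|\Phi^2_t(b,\cdot)\|\le Ke^{\alpha t}$ for $t\le0$; (ii) there is $M>0$ with $\|f(b)\|_\infty\le M$ for all $b\in B$, and the maps $b\mapsto\int_{-\infty}^0\varphi^1(-s,\theta_sb,f(b,s))\,ds$ and $b\mapsto\int_{-\infty}^0\varphi^2(s,\theta_{-s}b,f(b,-s))\,ds$ from $B$ to $H$ are continuous (here $\varphi^i$ is applied to the $\mathcal{V}^i$-component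 of the vector). For such a flow, for every $b\in B$ there is a unique bounded solution $(\theta_tb,e(b,t))$, $t\in\mathbb{R}$, for the flow $\Psi$, the map $e$ is continuous on $\mathbb{R}\times B$ with values in $H$, and $h_{aff}:B\times H\to B\times H$, $h_{aff}(b,x)=(b,x-e(b,0))$, is a homeomorphism with $h_{aff}(\Psi_t(b,x))=\Phi_t(h_{aff}(b,x))$. The set $\mathcal{R}=B\times\{0_H\}$ is the chain recurrent set of $\Phi$.
   Formalization: The sign of e is corrected: the central bundle is {(b, r e(b,0), r)} and the chain recurrent set of Ψ is h_aff^{-1}(R) = {(b, e(b,0))}, in place of −r e(b,0) and h_aff(R), which fail e.g. for B a point, H = ℝ, φ = e^{-t}x, f = 1. *)

(* Defs.v *)
From HB Require Import structures.
From mathcomp Require Import all_boot all_order all_algebra sesquilinear.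
From mathcomp Require Import all_classical all_reals all_analysis ess_sup_inf.
From mathcomp Require Import ring.

Set Implicit Arguments.
Unset Strict Implicit.
Unset Printing Implicit Defensive.

Import Order.TTheory GRing.Theory Num.Theory.
Import numFieldNormedType.Exports.

Local Open Scope classical_set_scope.
Local Open Scope ring_scope.

HB.mixin Record NormedVector_isHilbert (R : realType) V
    of NormedModule R V & Vector R V := {
  dotp : {dot V for (@idfun R)};
  norm_dotp : forall x : V, `|x| = Num.sqrt (dotp x x)
}.

#[short(type="fdHilbertType")]
HB.structure Definition FdHilbert (R : realType) :=
  {V of NormedModule R V & Vector R V & NormedVector_isHilbert R V}.

(* An alias of H * R: the library norms the plain product with the maximum. *)
Definition hprod (R : realType) (H : fdHilbertType R) : Type := (H * R^o)%type.

Section hprod_hilbert.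
Context (R : realType) (H : fdHilbertType R).
Local Notation H1 := (hprod H).

HB.instance Definition _ := Vector.copy H1 (H * R^o)%type.

Let hnorm (v : H1) : R := Num.sqrt (`|v.1| ^+ 2 + v.2 ^+ 2).

Let hnormZ (l : R) (v : H1) : hnorm (l *: v) = `|l| * hnorm v.
Proof.
rewrite /hnorm /= normrZ !exprMn real_normK ?num_real// -mulrDr.
by rewrite sqrtrM ?sqr_ge0// sqrtr_sqr.
Qed.

Let hnorm0_eq0 (v : H1) : hnorm v = 0 -> v = 0.
Proof.
case: v => x r /eqP; rewrite /hnorm sqrtr_eq0 /= => h.
have : `|x| ^+ 2 + r ^+ 2 == 0 by rewrite eq_le h addr_ge0 ?sqr_ge0.
rewrite paddr_eq0 ?sqr_ge0// !sqrf_eq0 normr_eq0 => /andP[/eqP-> /eqP->].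
by [].
Qed.

Let ler_hnormD (v w : H1) : hnorm (v + w) <= hnorm v + hnorm w.
Proof.
have sq0 (a b : R) : 0 <= a ^+ 2 + b ^+ 2 by rewrite addr_ge0 ?sqr_ge0.
case: v w => [x r] [y s]; rewrite /hnorm /=.
set a := `|x|; set b := `|y|.
set p := Num.sqrt (a ^+ 2 + r ^+ 2); set q := Num.sqrt (b ^+ 2 + s ^+ 2).
have p0 : 0 <= p by exact: sqrtr_ge0.
have q0 : 0 <= q by exact: sqrtr_ge0.
rewrite -[leRHS]ger0_norm ?addr_ge0// -sqrtr_sqr ler_sqrt ?sqr_ge0//.
have pE : p ^+ 2 = a ^+ 2 + r ^+ 2 by rewrite sqr_sqrtr.
have qE : q ^+ 2 = b ^+ 2 + s ^+ 2 by rewrite sqr_sqrtr.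
have cs : a * b + r * s <= p * q.
  apply: le_trans (ler_norm _) _.
  rewrite -[leRHS]ger0_norm ?mulr_ge0// -ler_sqr ?nnegrE//.
  rewrite !real_normK ?num_real// [leRHS]exprMn pE qE -subr_ge0.
  by rewrite [X in 0 <= X](_ : _ = (a * s - r * b) ^+ 2) ?sqr_ge0//; ring.
have tri : `|x + y| ^+ 2 <= (a + b) ^+ 2.
  have ab0 : 0 <= a + b by apply: addr_ge0; exact: normr_ge0.
  by rewrite ler_sqr ?nnegrE//; exact: ler_normD.
apply: le_trans (lerD tri (lexx _)) _.
rewrite !sqrrD pE qE.
rewrite -subr_ge0 [X in 0 <= X](_ : _ = (p * q - (a * b + r * s)) *+ 2).
  by rewrite mulrn_wge0// subr_ge0.
by rewrite !mulr2n; ring.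
Qed.

HB.instance Definition _ :=
  Lmodule_isNormed.Build R H1 ler_hnormD hnormZ hnorm0_eq0.

Lemma hprod_normE (v : H1) : `|v| = Num.sqrt (`|v.1| ^+ 2 + v.2 ^+ 2).
Proof. by []. Qed.

Definition hdot (v w : H1) : R := dotp v.1 w.1 + v.2 * w.2.

Let hdotC (v w : H1) : hdot v w = (-1) ^+ false * idfun (hdot w v).
Proof.
by rewrite expr0 mul1r /hdot (hermC (@dotp R H)) expr0 mul1r (mulrC v.2).
Qed.

Let hdotl (w : H1) : linear_for *%R (hdot^~ w).
Proof.
move=> k u v; rewrite /hdot /= linearPl /= mulrDl mulrDr.
by rewrite /GRing.scale /= mulrA !addrA; congr (_ + _); rewrite addrAC.
Qed.

Let hdotr (v : H1) : linear_for (@idfun R \; *%R) (hdot v).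
Proof.
have hC (x y : H1) : hdot x y = hdot y x by rewrite hdotC expr0 mul1r.
by move=> k w z; rewrite [LHS]hC (hdotl v) /= !(hC v).
Qed.

HB.instance Definition _ := bilinear_isBilinear.Build R H1 H1 R *%R
  (@idfun R \; *%R) hdot (hdotl, hdotr).
HB.instance Definition _ :=
  isHermitianSesquilinear.Build R H1 false (@idfun R) hdot hdotC.

Let hdotE (v : H1) : hdot v v = `|v| ^+ 2.
Proof.
have d0 : 0 <= dotp v.1 v.1.
  have [->|v0] := eqVneq v.1 0; first by rewrite linear0l.
  by apply/ltW/neq0_dnorm_gt0.
rewrite sqr_sqrtr ?addr_ge0 ?sqr_ge0//.
by rewrite norm_dotp sqr_sqrtr// /hdot expr2.
Qed.

Let hdot_gt0 (v : H1) : v != 0 -> 0 < hdot v v.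
Proof. by move=> v0; rewrite hdotE exprn_gt0// normr_gt0. Qed.

HB.instance Definition _ := isDotProduct.Build R H1 hdot hdot_gt0.

Let norm_hdot (v : H1) : `|v| = Num.sqrt (hdot v v).
Proof. by rewrite hdotE sqrtr_sqr normr_id. Qed.

HB.instance Definition _ := NormedVector_isHilbert.Build R H1 norm_hdot.

End hprod_hilbert.

Section projective_space.
Context (R : realType) (H : fdHilbertType R).

(* A point of P H is a line through the origin. *)
Record projspace : Type := Proj { pline :> {vspace H} ; _ : \dim pline == 1%N }.

HB.instance Definition _ := [isSub for pline].
HB.instance Definition _ := [Choice of projspace by <:].

Fact dim_line_subproof (x : H) : x != 0 -> \dim <[x]> == 1%N.
Proof. by move=> x0; rewrite dim_vline x0. Qed.

Definition projpt (x : H) (x0 : x != 0) : projspace := Proj (dim_line_subproof x0).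

Definition prep (p : projspace) : H := vpick p.

Lemma prep_neq0 p : prep p != 0.
Proof. by rewrite vpick0 -dimv_eq0; case: p => L /= /eqP ->. Qed.

Lemma projptK p (p0 : prep p != 0) : projpt p0 = p.
Proof.
apply/val_inj/eqP; case: p p0 => L /= dL p0.
by rewrite eqEdim (eqP dL) dim_vline p0 leqnn andbT -memvE memv_pick.
Qed.

Definition normalize (x : H) : H := `|x|^-1 *: x.

(* `|u - v| and `|u + v| are merely swapped when u or v changes sign, so the
   choice of representatives is immaterial; see proj_distE below. *)
Definition proj_dist (p q : projspace) : R :=
  let u := normalize (prep p) in let v := normalize (prep q) in
  Num.min `|u - v| `|u + v|.

Let distxx p : proj_dist p p = 0.
Proof.
by rewrite /proj_dist subrr normr0; apply/min_idPl; exact: normr_ge0.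
Qed.

Let normalize_line p : <[normalize (prep p)]>%VS = p :> {vspace H}.
Proof.
rewrite -[in RHS](projptK (prep_neq0 p)) /=; apply/eqP.
rewrite eqEdim !dim_vline scaler_eq0 invr_eq0 normr_eq0.
rewrite (negPf (prep_neq0 p)) /= leqnn andbT -memvE.
by apply/memvZ/memv_line.
Qed.

Let dist_eq0 p q : proj_dist p q = 0 -> p = q.
Proof.
move=> d0; apply/val_inj; rewrite /= -normalize_line -[RHS]normalize_line.
move: d0; rewrite /proj_dist /Num.min; case: ifP => _ /normr0_eq0.
  by move/eqP; rewrite subr_eq0 => /eqP ->.
move/eqP; rewrite addr_eq0 => /eqP ->; apply/eqP.
by rewrite eqEdim !dim_vline oppr_eq0 leqnn andbT -memvE memvN memv_line.
Qed.

Let dist_sym p q : proj_dist p q = proj_dist q p.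
Proof. by congr Num.min; [exact: distrC|rewrite addrC]. Qed.

Let dist_triangle q p r : proj_dist p r <= proj_dist p q + proj_dist q r.
Proof.
rewrite /proj_dist; set u := normalize _; set w := normalize _.
set v := normalize _.
have m1 (a b : R) : Num.min a b <= a by rewrite ge_min lexx.
have m2 (a b : R) : Num.min a b <= b by rewrite ge_min lexx orbT.
have tri (a b c : H) : a = b + c -> `|a| <= `|b| + `|c|.
  by move=> ->; exact: ler_normD.
have mE (a b : R) : Num.min a b = a \/ Num.min a b = b.
  by rewrite /Order.min; case: ifP; [left|right].
have [->|->] := mE `|u - v| `|u + v|; have [->|->] := mE `|v - w| `|v + w|.
- by apply: le_trans (m1 _ _) (tri _ _ _ _); rewrite addrA subrK.
- by apply: le_trans (m2 _ _) (tri _ _ _ _); rewrite addrA subrK.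
- apply: le_trans (m2 _ _) _; rewrite -(normrN (v - w)).
  by apply: tri; rewrite opprB addrA addrAC addrK.
- apply: le_trans (m1 _ _) _; rewrite -(normrN (v + w)).
  by apply: tri; rewrite opprD addrA addrK.
Qed.

HB.instance Definition _ :=
  isMetric.Build R projspace distxx dist_eq0 dist_sym dist_triangle.

Lemma proj_distE (x y : H) (x0 : x != 0) (y0 : y != 0) :
  mdist (projpt x0) (projpt y0) =
  Num.min `|normalize x - normalize y| `|normalize x + normalize y|.
Proof.
have nsgn (z : H) (z0 : z != 0) : exists b : bool,
    normalize (prep (projpt z0)) = (-1) ^+ b *: normalize z.
  have /vlineP[k kE] := memv_pick <[z]>.
  have k0 : k != 0.
    by apply: contra_neq (prep_neq0 (projpt z0)) => k0; rewrite /prep kE k0 scale0r.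
  exists (k < 0); rewrite /prep /normalize /= kE normrZ invfM !scalerA.
  congr (_ *: _); rewrite mulrAC; congr (_ * _).
  by rewrite {2}[k]realEsign ?num_real// mulrCA mulVf ?mulr1 ?normr_eq0.
rewrite /mdist /= /proj_dist.
have [a ->] := nsgn _ x0; have [b ->] := nsgn _ y0.
set u := normalize x; set v := normalize y.
have h1 : `|- u + v| = `|u - v| by rewrite addrC distrC.
have h2 : `|- u - v| = `|u + v| by rewrite -opprD normrN.
by case: a b => -[];
  rewrite /= ?expr0 ?expr1 ?scale1r ?scaleN1r ?opprK ?h1 ?h2 // minC.
Qed.

End projective_space.

(* Only ctime c i for i < clen c and cpt c i for i <= clen c are relevant. *)
Record chain (R : realType) (X : Type) : Type :=
  Chain { clen : nat; ctime : nat -> R; cpt : nat -> X }.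

Section chains.
Context (R : realType) (X : pseudoMetricType R).
Implicit Types (F : R -> X -> X) (eps T : R) (Y : set X).

Definition is_flow F : Prop :=
  [/\ continuous (fun z : R * X => F z.1 z.2),
      forall x, F 0 x = x &
      forall t s x, F (t + s) x = F t (F s x)].

(* On B * H and B * projspace H the library's balls are those of the maximum
   metric. *)
Definition is_chain F eps T (c : chain R X) : Prop :=
  (0 < clen c)%N /\
  forall i, (i < clen c)%N ->
    T <= ctime c i /\ ball (F (ctime c i) (cpt c i)) eps (cpt c i.+1).

Definition chain_from_to F eps T (x y : X) : Prop :=
  exists c : chain R X, [/\ is_chain F eps T c, cpt c 0%N = x & cpt c (clen c) = y].

Definition chain_recurrent_set F : set X :=
  [set x | forall eps T, 0 < eps -> 0 < T -> chain_from_to F eps T x x].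

Definition chain_transitive F Y : Prop :=
  forall x y, Y x -> Y y ->
  forall eps T, 0 < eps -> 0 < T -> chain_from_to F eps T x y.

(* Nonemptiness follows from maximality except for the empty set of an empty
   projective bundle (H = 0), which is not counted as a component. *)
Definition chain_component F Y : Prop :=
  [/\ Y !=set0, chain_transitive F Y &
      forall Z, chain_transitive F Z -> Y `<=` Z -> Z = Y].

End chains.

Section linear_flows.
Context (R : realType) (B : metricType R) (H : fdHilbertType R).
Implicit Types (theta : R -> B -> B) (phi : R -> B -> H -> H).
Implicit Types (V : set (B * H)) (U : B -> {vspace H}).

Definition skew_flow theta phi (t : R) (v : B * H) : B * H :=
  (theta t v.1, phi t v.1 v.2).

Definition is_linear_flow theta phi : Prop :=
  is_flow (skew_flow theta phi) /\ forall t b, linear (phi t b).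

(* For a linear flow phi t b is injective and the default of insubd is not
   used. *)
Definition projflow theta phi (t : R) (q : B * projspace H) : B * projspace H :=
  (theta t q.1, insubd q.2 <[phi t q.1 (prep q.2)]>%VS).

Definition bundle_of U : set (B * H) := [set v | v.2 \in U v.1].

Definition subbundle (k : nat) V : Prop :=
  closed V /\ exists2 U, forall b, \dim (U b) = k & V = bundle_of U.

Definition proj_bundle V : set (B * projspace H) :=
  [set q | exists x, exists x0 : x != 0, V (q.1, x) /\ q.2 = projpt x0].

Definition selgrade_bundle theta phi V : Prop :=
  exists2 M, chain_component (projflow theta phi) M &
    V = [set v | forall x0 : v.2 != 0, M (v.1, projpt x0)].

Definition chain_exponent phi (c : chain R (B * projspace H)) : R :=
  (\sum_(i < clen c)
     (ln `|phi (ctime c i) (cpt c i).1 (prep (cpt c i).2)|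
      - ln `|prep (cpt c i).2|))
  / \sum_(i < clen c) ctime c i.

Definition morse_spectrum theta phi V : set R :=
  [set l | exists eps T : R^nat, exists zeta : nat -> chain R (B * projspace H),
    [/\ forall k, 0 < eps k /\ 0 < T k,
        eps @ \oo --> (0 : R), T @ \oo --> +oo,
        forall k, is_chain (projflow theta phi) (eps k) (T k) (zeta k) /\
          forall i, (i <= clen (zeta k))%N -> proj_bundle V (cpt (zeta k) i) &
        (fun k => chain_exponent phi (zeta k)) @ \oo --> l]].

End linear_flows.

Section vector_integral.
Context (R : realType) (H : fdHilbertType R).
Local Notation mu := (@lebesgue_measure R).
Local Notation coordH := (coord (vbasis {:H})).

Definition measurable_vfun (F : R -> H) : Prop :=
  forall i, measurable_fun [set: R] (fun s => coordH i (F s)).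

Definition ess_normH (F : R -> H) : \bar R :=
  ess_sup mu (fun s => `|F s|%:E).

(* Integral of an H-valued function, taken in coordinates; for integrable F it
   does not depend on the basis. *)
Definition vintegral (D : set R) (F : R -> H) : H :=
  \sum_i (\int[mu]_(s in D) coordH i (F s)) *: (vbasis {:H})`_i.

Definition ointegral (a b : R) (F : R -> H) : H :=
  if a <= b then vintegral `[a, b] F else - vintegral `[b, a] F.

End vector_integral.

Section affine_flows.
Context (R : realType) (B : metricType R) (H : fdHilbertType R).
Implicit Types (theta : R -> B -> B) (phi psi : R -> B -> H -> H).
Implicit Types (f : B -> R -> H) (e : B -> R -> H).
Local Notation mu := (@lebesgue_measure R).

Definition inhomogeneity theta phi f (t : R) (b : B) : H :=
  ointegral 0 t (fun s => phi (t - s) (theta s b) (f b s)).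

(* f b is a representative of an element of L^oo(R, H); nesting the two
   "almost everywhere" makes the shift identity independent of the choice of
   representatives. *)
Definition is_affine_flow theta phi f psi : Prop :=
  [/\ is_linear_flow theta phi,
      forall b, measurable_vfun (f b) /\ (ess_normH (f b) < +oo)%E,
      forall b, {ae mu, forall s, {ae mu, forall t,
        f b (t + s) = f (theta s b) t}},
      forall t b x, psi t b x = phi t b x + inhomogeneity theta phi f t b &
      continuous (fun z : R * (B * H) => skew_flow theta psi z.1 z.2)].

Definition affine_lift theta phi f (t : R) (b : B) (v : hprod H) : hprod H :=
  (phi t b v.1 + v.2 *: inhomogeneity theta phi f t b, v.2).

(* daddv_pi U V is the projection onto U along V. *)
Definition uniformly_hyperbolic theta phi f : Prop :=
  exists U1 U2 : B -> {vspace H},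
  let pi1 b := daddv_pi (U1 b) (U2 b) in
  let pi2 b := daddv_pi (U2 b) (U1 b) in
  [/\ (exists k1 k2, subbundle k1 (bundle_of U1) /\
         subbundle k2 (bundle_of U2)),
      (forall b, (U1 b + U2 b = fullv)%VS /\ (U1 b :&: U2 b = 0)%VS),
      (forall t b x, (x \in U1 b -> phi t b x \in U1 (theta t b)) /\
         (x \in U2 b -> phi t b x \in U2 (theta t b))),
      (exists alpha K : R, [/\ 0 < alpha, 0 < K,
         forall b t x, 0 <= t -> x \in U1 b ->
           `|phi t b x| <= K * expR (- alpha * t) * `|x| &
         forall b t x, t <= 0 -> x \in U2 b ->
           `|phi t b x| <= K * expR (alpha * t) * `|x|]) &
      [/\ (exists2 M : R, 0 < M & forall b, (ess_normH (f b) <= M%:E)%E),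
         continuous (fun b => vintegral `]-oo, 0] (fun s =>
           phi (- s) (theta s b) (pi1 (theta s b) (f b s)))) &
         continuous (fun b => vintegral `]-oo, 0] (fun s =>
           phi s (theta (- s) b) (pi2 (theta (- s) b) (f b (- s)))))]].

Definition bounded_solution psi (b : B) (u : R -> H) : Prop :=
  (forall t, u t = psi t b (u 0)) /\ exists C : R, forall t, `|u t| <= C.

Definition h_aff e (v : B * H) : B * H := (v.1, v.2 - e v.1 0).

Definition zero_section : set (B * H) := [set v | v.2 = 0].

Definition at_infinity (V : set (B * H)) : set (B * hprod H) :=
  [set v | V (v.1, v.2.1) /\ v.2.2 = 0].

Definition central_bundle theta phi f (W : set (B * hprod H)) : Prop :=
  selgrade_bundle theta (affine_lift theta phi f) W /\
  exists v, W v /\ v.2.2 != 0.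

(* If e b is a solution of the affine flow, then t |-> (r *: e b t, r) is one of
   its lift; this fixes the sign, - r *: e b 0 would not give an invariant
   line. *)
Definition bounded_line e : set (B * hprod H) :=
  [set (br.1, (br.2 *: e br.1 0, br.2) : hprod H) | br in [set: B * R]].

Fact affine_neq0_subproof (x : H) : ((x, 1) : hprod H) != 0.
Proof. by apply/eqP => -[_ /eqP]; rewrite oner_eq0. Qed.

Definition affine_pt (x : H) : projspace (hprod H) :=
  projpt (affine_neq0_subproof x).

Definition proj11 : set (projspace (hprod H)) :=
  [set p | exists v : hprod H, exists v0 : v != 0,
     v.2 != 0 /\ p = projpt v0].

End affine_flows.
Arguments zero_section {R B H}.
Arguments proj11 {R H}.

(* Main.v *)
Require Import Defs.
From HB Require Import structures.
From mathcomp Require Import all_boot all_order all_algebra.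
From mathcomp Require Import all_classical all_reals all_analysis.
From mathcomp Require Import measurable_realfun ess_sup_inf ring lra.

Set Implicit Arguments.
Unset Strict Implicit.
Unset Printing Implicit Defensive.

Import Order.TTheory GRing.Theory Num.Theory.
Import numFieldNormedType.Exports.

Local Open Scope classical_set_scope.
Local Open Scope ring_scope.

(* Write E b = e b 0. In the fiber coordinate y = x - r E b the lift acts as
   y |-> phi t b y and r |-> r, so that every vector of B x H^1 splits into a
   stable, a central and an unstable part. The relative size of the unstable
   part, and that of the unstable and central parts together, are repelled from
   0 towards 1 by the flow. Hence they cannot drop along fine chains, and on a
   chain transitive set each of them is constantly 0 or constantly 1: the set
   lies either at infinity or on the line spanned by (E b, 1). In the first case
   fine chains between points of the set stay away from that line, and
   (x, r) |-> (x - r E b, 0), which commutes with the flow, projects them to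
   chains at infinity. The line itself is a copy of the base flow.
   Every bounded orbit obeys one uniform bound, so the graph of E is closed, and
   E is continuous because its values lie in a compact ball. *)

(** * Topological preliminaries *)

(** Chain transitivity of a set says nothing about the intermediate points of the chains that join
    its points: a chain between two points at infinity may pass through finite points and could a
    priori reach the central line, where the projection to infinity is undefined. Locating the chain
    transitive sets is therefore not enough, and the repelling property is used quantitatively along
    whole chains. Two ratios are needed because the central part neither grows nor decays, so that
    it must be compared with the unstable and with the stable part separately. Write a, c, r for the
    sizes of the stable, unstable and central parts. In c / (a + c + r) the growth of c beats a
    bounded a + r; in (c + r) / (a + c + r) the decay of a loses to a nondecreasing c + r. The value
    1 of the first ratio leaves only the unstable part, the value 0 of the second only the stable
    part, and the values 0 and 1 together only the central part. *)

Lemma closed_le_continuous (X : topologicalType) (R : realType) (g : X -> R) r :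
  continuous g -> closed [set x | g x <= r].
Proof.
move=> cg; rewrite (_ : [set x | _] = g @^-1` [set y | y <= r]) //.
by apply: preimage_closed; [move=> x _; exact: cg|exact: closed_le].
Qed.

Lemma closed_eq_continuous (X : topologicalType) (R : realType) (g : X -> R) r :
  continuous g -> closed [set x | g x = r].
Proof.
move=> cg; rewrite (_ : [set x | _] = g @^-1` [set y | y = r]) //.
by apply: preimage_closed; [move=> x _; exact: cg|exact: closed_eq].
Qed.

Lemma continuous_at_pair (T X Y : topologicalType) (g : T -> X) (h : T -> Y) z :
  {for z, continuous g} -> {for z, continuous h} ->
  {for z, continuous (fun z => (g z, h z))}.
Proof. by move=> cg ch; exact: (cvg_pair cg ch). Qed.

Lemma continuous_norm (R : realType) (V : normedModType R) (T : topologicalType)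
    (g : T -> V) : continuous g -> continuous (fun z => `|g z|).
Proof.
by move=> cg z; apply: (@continuous_comp _ _ _ g (@Num.norm _ V) z (cg z));
  exact: norm_continuous.
Qed.

(** A linear flow comes with linearity as a predicate on each map; the bundled form gives access to
    the theory of linear maps. *)
Definition linear_of (R : realType) (H H' : lmodType R) (L : H -> H') (linL :
  linear L) :
  {linear H -> H'} := HB.pack L (GRing.isLinear.Build R H H' _ L linL).

(** * Coordinates and compact balls in finite dimension *)

Section finite_dimension.
Context (R : realType) (H : fdHilbertType R).
Local Notation bs := (vbasis {:H}).

Let comb (c : 'rV[R]_(\dim {:H})) : H := \sum_i c 0 i *: bs`_i.

Let comb_coord (x : H) : comb (\row_i coord bs i x) = x.
Proof.
rewrite [RHS](coord_vbasis (memvf x)) /comb.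
by apply: eq_bigr => i _; rewrite mxE.
Qed.

Let coord_comb (c : 'rV[R]_(\dim {:H})) i : coord bs i (comb c) = c 0 i.
Proof. by rewrite /comb coord_sum_free //; exact: basis_free (vbasisP _). Qed.

Let comb_continuous : continuous comb.
Proof.
rewrite /comb; elim: (index_enum _) => [|i s IHs].
  by rewrite (_ : (fun c => _) = cst 0);
    [exact: cst_continuous|apply/funext => c; rewrite big_nil].
rewrite (_ : (fun c => _) = fun c : 'rV[R]_(\dim {:H}) =>
    c 0 i *: bs`_i + \sum_(j <- s) c 0 j *: bs`_j);
  last by apply/funext => c; rewrite big_cons.
move=> c; apply: (@cvgD _ _ _ (nbhs c) _ (fun c => c 0 i *: bs`_i));
  last exact: IHs.
by apply: cvgZr_tmp; exact: coord_continuous.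
Qed.

Let combZ k c : comb (k *: c) = k *: comb c.
Proof.
by rewrite /comb scaler_sumr; apply: eq_bigr => i _; rewrite mxE scalerA.
Qed.

(** Equivalence of norms: [m] is the minimum of the norm of [comb] over the compact unit sphere of
    coordinate vectors, positive because the basis is free. *)
Let comb_lower : exists2 m : R, 0 < m & forall c, m * `|c| <= `|comb c|.
Proof.
pose S := [set c : 'rV[R]_(\dim {:H}) | `|c| = 1].
have cS : compact S.
  apply: bounded_closed_compact.
    by exists 1; split; [exact: num_real|move=> y y1 c /= ->; exact: ltW].
  exact/closed_eq_continuous/norm_continuous.
(* The sphere is empty in dimension 0, where there is no minimum to take. *)
have [S0|/set0P S0] := eqVneq S set0.
  exists 1 => // c; rewrite mul1r.
  have [->|c0] := eqVneq c 0; first by rewrite normr0.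
  have : S (`|c|^-1 *: c).
    by rewrite /S/= normrZ normfV normr_id mulVf ?normr_eq0.
  by rewrite S0.
have cf : {within S, continuous (fun c => `|comb c|)}.
  apply: continuous_subspaceT => c.
  by apply: continuous_comp; [exact: comb_continuous|exact: norm_continuous].
have [c0 c0S c0m] := compact_EVT_min S0 cS cf.
move: c0S; rewrite inE /S/= => c0S.
exists `|comb c0|.
  rewrite normr_gt0; apply/eqP => c00.
  suff c0E : c0 = 0 by move: c0S; rewrite c0E normr0 => /esym/eqP;
    rewrite oner_eq0.
  by apply/rowP => i; rewrite -coord_comb c00 linear0 mxE.
move=> c; have [->|cn0] := eqVneq c 0; first by rewrite normr0 mulr0.
have n0 : 0 < `|c| by rewrite normr_gt0.
have /c0m : `|c|^-1 *: c \in S.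
  by rewrite inE /S/= normrZ normfV normr_id mulVf ?normr_eq0.
by rewrite combZ normrZ normfV normr_id mulrC ler_pdivlMr.
Qed.

Lemma coord_le : exists2 C : R, 0 < C & forall i (x : H),
  `|coord bs i x| <= C * `|x|.
Proof.
have [m m0 hm] := comb_lower; exists m^-1; first by rewrite invr_gt0.
move=> i x; rewrite mulrC ler_pdivlMr// mulrC.
apply: le_trans (_ : m * `|\row_i coord bs i x| <= _); last first.
  by rewrite -[in leRHS](comb_coord x).
rewrite ler_pM2l//.
set c := (X in _ <= `|X|); have -> : coord bs i x = c 0 i by rewrite mxE.
rewrite [leRHS]/Num.norm/= mx_normrE; by apply/bigmax_geP; right; exists (0,
  i) => //=; exact: lexx.
Qed.

Lemma coord_vbasis_continuous i : continuous (coord bs i : H -> R).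
Proof.
have [C C0 hC] := coord_le.
apply/linear_bounded_continuous/bounded_funP => r.
exists (C * r) => x xr; apply: le_trans (hC i x) _.
by rewrite ler_pM2l.
Qed.

Lemma compact_closed_ball0 (r : R) : compact [set x : H | `|x| <= r].
Proof.
have [m m0 hm] := comb_lower.
apply: (@subclosed_compact _ _ (comb @` [set c | `|c| <= r / m])).
- exact/closed_le_continuous/norm_continuous.
- apply: continuous_compact; first exact: continuous_subspaceT.
  apply: bounded_closed_compact.
    exists (r / m); split; [exact: num_real|move=> y y1 c /= h].
    by apply: le_trans h _; exact: ltW.
  exact/closed_le_continuous/norm_continuous.
- move=> x /= xr; exists (\row_i coord bs i x); last exact: comb_coord.
  rewrite /= ler_pdivlMr// mulrC; apply: le_trans (hm _) _.
  by rewrite comb_coord.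
Qed.

End finite_dimension.

(* Heine-Cantor, where only the first of the two nearby points is in [K]. *)
Lemma compact_heine (R : realType) (X Y : pseudoMetricType R) (K : set X)
    (g : X -> Y) : compact K -> (forall x, K x -> {for x, continuous g}) ->
  forall eps, 0 < eps -> exists2 d : R, 0 < d &
    forall x y, K x -> ball x d y -> ball (g x) eps (g y).
Proof.
move=> /compact_near_coveringP cK cg eps e0.
have : \forall d \near (0 : R)^'+,
    K `<=` (fun x => forall y, ball x d y -> ball (g x) eps (g y)).
  apply: cK => x Kx.
  have e20 : 0 < eps / 2 by rewrite divr_gt0.
  have /nbhs_ballP[/= d d0 hd] := cg x Kx _ (nbhsx_ballx (g x) _ e20).
  have d20 : 0 < d / 2 by rewrite divr_gt0.
  exists (ball x (d / 2), [set r | r < d / 2]).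
    split; first exact: nbhsx_ballx.
    exact: nbhs_right_lt.
  move=> [x' r] [/= xx' rd] y x'y; rewrite [eps]splitr.
  apply: (@ball_triangle _ _ (g x)).
    apply: ball_sym; apply: hd; apply: le_ball xx'.
    by rewrite ler_pdivrMr// ler_peMr ?(ltW d0)// ler1n.
  apply: hd; rewrite [d]splitr; apply: ball_triangle xx' _.
  by apply: le_ball x'y; exact: ltW.
move=> h; near (0 : R)^'+ => d; exists d => // x y Kx.
by have : K `<=` (fun x => forall y, ball x d y -> ball (g x) eps (g y));
  [near: d; exact: h|move=> /(_ x Kx) /(_ y)].
Unshelve. all: by end_near. Qed.

(** A point [y] of [K] other than [g x] has a neighborhood that the values of [g] near [x] avoid,
    because the graph is closed. Compactness of [K] makes one neighborhood of [x] serve for all [y],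
    and nearby values are left no place outside [U]. *)
Lemma closed_graph_continuous (X Y : topologicalType) (K : set Y) (g : X -> Y)
    (x : X) : compact K -> (\forall x' \near x, K (g x')) ->
  closed [set z : X * Y | z.2 = g z.1] -> {for x, continuous g}.
Proof.
move=> /compact_near_coveringP cK gK clg U /= Ux.
have : \forall x' \near x, K `<=` (fun y => U y \/ y <> g x').
  apply: cK => y Ky; have [yx|yx] := pselect (y = g x).
    exists (U, setT); first by split; [rewrite yx|exact: filterT].
    by case=> y' x' [/= ? _]; left.
  have : nbhs (x, y) (~` [set z : X * Y | z.2 = g z.1]).
    by apply: open_nbhs_nbhs; split; [exact: closed_openC|].
  case=> [[P Q] /= [Px Qy] PQ]; exists (Q, P) => //.
  by case=> y' x' [/= Qy' Px']; right; exact: (PQ (x', y')).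
move=> h; rewrite /nbhs/=; near=> x'.
have [] // : U (g x') \/ g x' <> g x'.
have : K `<=` (fun y => U y \/ y <> g x') by near: x'; exact: h.
by apply; near: x'.
Unshelve. all: by end_near. Qed.

(** * Integrals and the cocycle property of affine flows *)

Section translation.
Context (R : realType).
Local Notation mu := (@lebesgue_measure R).

Let shift (s : R) (u : measurableTypeR R) : measurableTypeR R := u + s.

Let measurable_shift (s : R) : measurable_fun [set: measurableTypeR R] (shift s).
Proof. by apply: measurable_funD. Qed.

Let shift_measure (s : R) : exists nu : {measure set (measurableTypeR R) ->
  \bar R},
  (nu : set _ -> \bar R) = pushforward mu (shift s).
Proof.
by exists (measure_function_pushforward__canonical__measure_function_Measure mu
  (@measurable_shift s)).
Qed.

Let preimage_shift s (x y : R) (l r : bool) : shift s @^-1`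
    [set` Interval (BSide l (x + s)) (BSide r (y + s))] =
    [set` Interval (BSide l x) (BSide r y)].
Proof.
by apply/seteqP; split => u /=; rewrite !in_itv/= /Order.lteif;
  case: l; case: r; rewrite ?lerD2r ?ltrD2r.
Qed.

(** By uniqueness of Lebesgue measure it is enough to compare the two measures on half-open
    intervals. *)
Let lebesgue_measure_shift s A : measurable A ->
  mu A = pushforward mu (shift s) A.
Proof.
have [nu nuE] := shift_measure s; rewrite -nuE.
apply: lebesgue_measure_unique => X [[x y] _ <-] /=.
rewrite nuE /pushforward -[x](subrK s) -[y](subrK s) preimage_shift !subrK.
rewrite !lebesgue_measure_itv/= !lte_fin ltrD2r.
by case: ifP => // _; rewrite -!EFinB; congr _%:E; ring.
Qed.

Lemma integrable_shift (s a b : R) (g : R -> R) :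
  measurable_fun [set: R] g -> mu.-integrable `[a + s, b + s] (EFin \o g) ->
  mu.-integrable `[a, b] (EFin \o (fun u => g (u + s))).
Proof.
move=> mg ig; rewrite -(preimage_shift s a b true false).
apply/integrableP; split.
  apply/measurable_EFinP; apply: measurableT_comp => //.
  by apply: measurable_funTS; exact: measurable_shift.
have /integrableP[_] := ig; apply: le_lt_trans.
have [nu nuE] := shift_measure s.
have -> : (\int[mu]_(u in shift s @^-1` `[(a + s)%R, (b + s)%R])
    `|(EFin \o (fun u : R => g (u + s)%R)) u| =
    \int[nu]_(u in `[(a + s)%R, (b + s)%R]) `|(g u)%:E|)%E.
  rewrite nuE ge0_integral_pushforward//.
  by apply: measurableT_comp => //; apply/measurable_EFinP;
    exact: measurable_funTS.
rewrite le_eqVlt; apply/orP; left; apply/eqP; apply/esym.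
by apply: eq_measure_integral => A mA _; rewrite nuE;
  exact: lebesgue_measure_shift.
Qed.

Lemma Rintegral_shift (s a b : R) (g : R -> R) :
  measurable_fun [set: R] g -> mu.-integrable `[a + s, b + s] (EFin \o g) ->
  \int[mu]_(u in `[a + s, b + s]) g u = \int[mu]_(u in `[a, b]) g (u + s).
Proof.
move=> mg ig; rewrite /Rintegral; congr fine.
have [nu nuE] := shift_measure s.
transitivity (\int[nu]_(u in `[(a + s)%R, (b + s)%R]) (g u)%:E)%E.
  by apply: eq_measure_integral => A mA _; rewrite nuE;
    exact: lebesgue_measure_shift.
rewrite nuE (@integral_pushforward _ _ _ _ R (shift s) _ mu `[a + s,
  b + s] (EFin \o g)) //.
- by rewrite preimage_shift.
- by apply/measurable_EFinP.
- by rewrite preimage_shift; exact: integrable_shift.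
Qed.

End translation.

Section cocycle.
Context (R : realType).
Local Notation mu := (@lebesgue_measure R).

Lemma lebesgue_ae_imply (P Q : R -> Prop) : {ae mu, forall u, P u} ->
  (forall u, P u -> Q u) -> {ae mu, forall u, Q u}.
Proof.
by move=> [N [mN N0 PN]] PQ; exists N; split=> // u nQ; apply: PN => /PQ.
Qed.

Definition oRintegral (a b : R) (g : R -> R) : R :=
  if a <= b then \int[mu]_(u in `[a, b]) g u else - \int[mu]_(u in `[b, a]) g u.

Definition loc_integrable (g : R -> R) :=
  measurable_fun [set: R] g /\ forall a b : R, mu.-integrable `[a, b] (EFin \o g).

Let RintegralU (a b c : R) g : loc_integrable g -> a <= b -> b <= c ->
  \int[mu]_(u in `[a, c]) g u =
  \int[mu]_(u in `[a, b]) g u + \int[mu]_(u in `[b, c]) g u.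
Proof.
move=> [mg ig] ab bc; apply/eqP; rewrite addrC -subr_eq; apply/eqP.
rewrite (Rintegral_itvB (x := b)) ?bnd_simp//=.
apply: Rintegral_itv_obnd_cbnd.
apply: integrableS (ig b c) => //; apply: subset_itvr; rewrite bnd_simp//.
Qed.

Lemma oRintegralD (a b c : R) g : loc_integrable g ->
  oRintegral a c g = oRintegral a b g + oRintegral b c g.
Proof.
move=> ig; rewrite /oRintegral; case: (leP a b) => ab; case: (leP b c) => bc;
  case: (leP a c) => ac.
- exact: RintegralU.
- lra.
- by rewrite (RintegralU ig ac (ltW bc)) addrK.
- by rewrite (RintegralU ig (ltW ac) ab); ring.
- by rewrite (RintegralU ig (ltW ab) ac); ring.
- by rewrite (RintegralU ig bc (ltW ac)); ring.
- lra.
- by rewrite (RintegralU ig (ltW bc) (ltW ab)); ring.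
Qed.

Lemma oRintegral_shift (s a b : R) g : loc_integrable g ->
  oRintegral (a + s) (b + s) g = oRintegral a b (fun u => g (u + s)).
Proof.
by move=> [mg ig]; rewrite /oRintegral lerD2r !Rintegral_shift.
Qed.

Lemma loc_integrable_shift s g : loc_integrable g ->
  loc_integrable (fun u => g (u + s)).
Proof.
move=> [mg ig]; split; last by move=> a b; exact: integrable_shift.
by apply: measurableT_comp => //; exact: measurable_funD.
Qed.

Lemma oRintegralZ k (a b : R) g : loc_integrable g ->
  oRintegral a b (fun u => k * g u) = k * oRintegral a b g.
Proof. by move=> [mg ig]; rewrite /oRintegral !RintegralZl//; case: ifP;
  rewrite ?mulrN. Qed.

Lemma loc_integrableD g h : loc_integrable g -> loc_integrable h ->
  loc_integrable (fun u => g u + h u).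
Proof.
move=> [mg ig] [mh ih]; split; first exact: measurable_funD.
by move=> a b; apply: eq_integrable (integrableD _ (ig a b) (ih a b)).
Qed.

Lemma loc_integrable0 : loc_integrable (fun=> 0).
Proof.
by split=> [|a b]; [exact: measurable_cst|exact: integrable0].
Qed.

Lemma loc_integrable_sum I (r : seq I) (g : I -> R -> R) :
  (forall i, loc_integrable (g i)) -> loc_integrable (fun u =>
    \sum_(i <- r) g i u).
Proof.
move=> ig; elim: r => [|i r IHr].
  by under eq_fun do rewrite big_nil; exact: loc_integrable0.
by under eq_fun do rewrite big_cons; exact: loc_integrableD.
Qed.

Lemma oRintegral_sum I (r : seq I) (a b : R) (g : I -> R -> R) :
  (forall i, loc_integrable (g i)) ->
  oRintegral a b (fun u => \sum_(i <- r) g i u) = \sum_(i <- r) oRintegral a b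
    (g i).
Proof.
move=> ig; have E x y : \int[mu]_(u in `[x, y]) (\sum_(i <- r) g i u) =
    \sum_(i <- r) \int[mu]_(u in `[x, y]) g i u.
  elim: r => [|i r IHr].
    under eq_Rintegral do rewrite big_nil.
    by rewrite big_nil Rintegral_cst// mul0r.
  under eq_Rintegral do rewrite big_cons.
  rewrite big_cons -IHr RintegralD//; first exact: (ig i).2.
  exact: (loc_integrable_sum r ig).2.
by rewrite /oRintegral; case: ifP => _ //; rewrite E // sumrN.
Qed.

(** The shape of the terms of the integrand of [inhomogeneity]: [k] is a coordinate of [f b],
    bounded only almost everywhere, and [c] a matrix entry of the linear flow. *)
Lemma loc_integrableMae (k c : R -> R) (M : R) : measurable_fun [set: R] k ->
  {ae mu, forall u, `|k u| <= M} -> continuous c ->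
  loc_integrable (fun u => k u * c u).
Proof.
move=> mk kM cc.
have mc : measurable_fun [set: R] c by exact: continuous_measurable_fun.
split=> [|a b]; first exact: measurable_funM.
have mkc : measurable_fun `[a, b] (EFin \o (fun u => k u * c u)).
  by apply/measurable_EFinP; apply: measurable_funTS; exact: measurable_funM.
apply/integrableP; split => //.
have : compact (c @` `[a, b]).
  by apply: continuous_compact; [exact: continuous_subspaceT|exact:
    segment_compact].
move=> /compact_bounded[C [_ hC]].
pose D := (`|C| + 1) * `|M|.
apply: le_lt_trans (_ : (D%:E * mu `[a, b] < +oo)%E); last first.
  rewrite lebesgue_measure_itv/=; case: ifP => _; last by rewrite mule0 ltry.
  by rewrite -EFinB -EFinM ltry.
apply: integral_le_bound => //.
  by rewrite lee_fin mulr_ge0.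
apply: lebesgue_ae_imply kM _ => u uM uab /=;
  rewrite lee_fin normrM mulrC ler_pM//.
  apply: hC; last by exists u.
  by rewrite (le_lt_trans (ler_norm _))// ltrDl.
by apply: le_trans uM _; exact: ler_norm.
Qed.

Lemma ae_eq_oRintegral (a b : R) g h : loc_integrable g -> loc_integrable h ->
  {ae mu, forall u, g u = h u} -> oRintegral a b g = oRintegral a b h.
Proof.
move=> [mg _] [mh _] gh.
have E x y : \int[mu]_(u in `[x, y]) g u = \int[mu]_(u in `[x, y]) h u.
  congr fine; apply: ae_eq_integral => //.
  - by apply/measurable_EFinP; exact: measurable_funTS.
  - by apply/measurable_EFinP; exact: measurable_funTS.
  - by apply: lebesgue_ae_imply gh _ => u ->.
by rewrite /oRintegral !E.
Qed.

(** A point outside [P] would have a ball around it outside [P], of positive measure inside a null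
    set. *)
Lemma ae_closed_setT (P : set R) : closed P -> {ae mu, forall u, P u} ->
  forall u, P u.
Proof.
move=> cP [N [mN N0 PN]] u; apply: contrapT => nPu.
have : nbhs u (~` P) by apply: open_nbhs_nbhs; split; [exact: closed_openC|].
move=> /nbhs_ballP[e /= e0 ue].
have : (mu (ball u e) <= mu N)%E.
  apply: le_measure; rewrite ?inE//; first exact: measurable_ball.
  by move=> v /ue nPv; exact: PN.
rewrite [X in (_ <= X)%E](_ : _ = 0%E)// lebesgue_measure_ball ?(ltW e0)//
  leNgt lte_fin.
by rewrite mulrn_wgt0.
Qed.

End cocycle.

Section vector_integral_theory.
Context (R : realType) (H : fdHilbertType R).
Local Notation mu := (@lebesgue_measure R).
Local Notation bs := (vbasis {:H}).
Implicit Types F G : R -> H.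

Definition loc_integrable_vfun F := forall i, loc_integrable (fun u =>
  coord bs i (F u)).

Lemma ointegralE a b F :
  ointegral a b F = \sum_i oRintegral a b (fun u => coord bs i (F u)) *: bs`_i.
Proof.
rewrite /ointegral /oRintegral /vintegral; case: ifP => _ //.
by rewrite -sumrN; apply: eq_bigr => i _; rewrite scaleNr.
Qed.

Lemma coord_ointegral a b F i :
  coord bs i (ointegral a b F) = oRintegral a b (fun u => coord bs i (F u)).
Proof.
by rewrite ointegralE coord_sum_free //; exact: basis_free (vbasisP _).
Qed.

Lemma ointegralD a b c F : loc_integrable_vfun F ->
  ointegral a c F = ointegral a b F + ointegral b c F.
Proof.
move=> iF; rewrite !ointegralE -big_split; apply: eq_bigr => i _ /=.
by rewrite -scalerDl -oRintegralD.
Qed.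

Lemma ointegral_shift s a b F : loc_integrable_vfun F ->
  ointegral (a + s) (b + s) F = ointegral a b (fun u => F (u + s)).
Proof.
move=> iF; rewrite !ointegralE; apply: eq_bigr => i _ /=.
by rewrite oRintegral_shift.
Qed.

Lemma ae_eq_ointegral a b F G : loc_integrable_vfun F -> loc_integrable_vfun G ->
  {ae mu, forall u, F u = G u} -> ointegral a b F = ointegral a b G.
Proof.
move=> iF iG FG; rewrite !ointegralE; apply: eq_bigr => i _; congr (_ *: _).
by apply: ae_eq_oRintegral => //; apply: lebesgue_ae_imply FG _ => u ->.
Qed.

(** The integral is defined in coordinates, so [L] is exchanged with it through its matrix in the
    basis. *)
Lemma ointegral_linear a b F (L : H -> H) : linear L -> loc_integrable_vfun F ->
  ointegral a b (fun u => L (F u)) = L (ointegral a b F).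
Proof.
move=> linL iF; pose L' := linear_of linL.
have LE x : L x = \sum_j coord bs j x *: L bs`_j.
  rewrite -[L]/(L' : H -> H) [in LHS](coord_vbasis (memvf x)) linear_sum.
  by apply: eq_bigr => j _; rewrite linearZ.
rewrite LE ointegralE [RHS](coord_vbasis (memvf _)); apply: eq_bigr => i _.
congr (_ *: _); rewrite linear_sum.
under eq_bigr do rewrite linearZ /= coord_ointegral mulrC -oRintegralZ//.
rewrite -oRintegral_sum; last first.
  move=> j; split; first by apply: measurable_funM => //; exact: (iF j).1.
  by move=> x y; apply: eq_integrable (integrableZl _ _ ((iF j).2 x y)).
congr oRintegral; apply/funext => u; rewrite LE linear_sum.
by apply: eq_bigr => j _; rewrite linearZ /= mulrC.
Qed.

(** Meant for [L u = phi (t - u) (theta u b)]. Continuity in [u] at each fixed vector already gives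
    continuous matrix entries. *)
Lemma loc_integrable_vfun_linear (g : R -> H) (L : R -> H -> H) :
  measurable_vfun g -> (ess_normH g < +oo)%E ->
  (forall u, linear (L u)) -> (forall x, continuous (fun u => L u x)) ->
  loc_integrable_vfun (fun u => L u (g u)).
Proof.
move=> mg ng linL cL i.
have LE u x : L u x = \sum_j coord bs j x *: L u bs`_j.
  pose L' := linear_of (linL u).
  rewrite -[L u]/(L' : H -> H) [in LHS](coord_vbasis (memvf x)) linear_sum.
  by apply: eq_bigr => j _; rewrite linearZ.
rewrite (_ : (fun u => _) =
    fun u => \sum_j coord bs j (g u) * coord bs i (L u bs`_j)); last first.
  apply/funext => u; rewrite LE linear_sum.
  by apply: eq_bigr => j _; rewrite linearZ.
apply: loc_integrable_sum => j.
have [M gM] := ess_supr_bounded ng; have [C C0 hC] := coord_le H.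
apply: (@loc_integrableMae _ _ _ (C * M)); first exact: mg.
  apply: lebesgue_ae_imply gM _ => u uM; apply: le_trans (hC _ _) _.
  by rewrite ler_pM2l.
move=> u; apply: (@continuous_comp _ _ _ (fun u => L u bs`_j)); first exact: cL.
exact: coord_vbasis_continuous.
Qed.

End vector_integral_theory.

(** * The flow property of affine flows *)

Section affine_cocycle.
Context (R : realType) (B : metricType R) (H : fdHilbertType R).
Context (theta : R -> B -> B) (phi psi : R -> B -> H -> H) (f : B -> R -> H).
Hypothesis theta_flow : is_flow theta.
Hypothesis affine : is_affine_flow theta phi f psi.
Local Notation mu := (@lebesgue_measure R).
Local Notation inh := (inhomogeneity theta phi f).

Lemma theta0 b : theta 0 b = b.
Proof. by case: theta_flow. Qed.

Lemma thetaD t s b : theta (t + s) b = theta t (theta s b).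
Proof. by case: theta_flow. Qed.

Lemma phi_linear t b : linear (phi t b).
Proof. by case: affine => -[]. Qed.

Lemma phi0 b x : phi 0 b x = x.
Proof. by case: affine => -[[_ h _] _] _ _ _ _; have [] := h (b, x). Qed.

Lemma phiD t s b x : phi (t + s) b x = phi t (theta s b) (phi s b x).
Proof. by case: affine => -[[_ _ h] _] _ _ _ _; have [] := h t s (b, x). Qed.

Lemma psiE t b x : psi t b x = phi t b x + inh t b.
Proof. by case: affine. Qed.

Lemma theta_continuous : continuous (fun z : R * B => theta z.1 z.2).
Proof. by case: theta_flow. Qed.

Lemma phi_continuous : continuous (fun z : R * (B * H) => phi z.1 z.2.1 z.2.2).
Proof.
case: affine => -[[c _ _] _] _ _ _ _ z.
by apply: (@continuous_comp _ _ _ _ snd _ (c z)); exact: cvg_snd.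
Qed.

Lemma psi_continuous : continuous (fun z : R * (B * H) => psi z.1 z.2.1 z.2.2).
Proof.
case: affine => _ _ _ _ c z.
by apply: (@continuous_comp _ _ _ _ snd _ (c z)); exact: cvg_snd.
Qed.

(** Makes the integral continuous in time and base point, as a value of the continuous [psi]. *)
Lemma inh_psi t b : inh t b = psi t b 0.
Proof.
pose L := linear_of (phi_linear t b).
by rewrite psiE -[phi t b]/(L : H -> H) linear0 add0r.
Qed.

Let inh_continuous (T : topologicalType) (t : T -> R) (b : T -> B) :
  continuous t -> continuous b -> continuous (fun z => inh (t z) (b z)).
Proof.
move=> ct cb z; under eq_fun do rewrite inh_psi.
apply: (@continuous_comp _ _ _ (fun z => (t z, (b z, 0))) (fun z :
  R * (B * H) => psi z.1 z.2.1 z.2.2)).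
  by apply: continuous_at_pair; [exact: ct|apply: continuous_at_pair;
    [exact: cb|exact: cvg_cst]].
exact: psi_continuous.
Qed.

Let phi_continuousW (T : topologicalType) (t : T -> R) (b : T -> B) (x : T -> H) :
  continuous t -> continuous b -> continuous x -> continuous (fun z =>
    phi (t z) (b z) (x z)).
Proof.
move=> ct cb cx z.
apply: (@continuous_comp _ _ _ (fun z => (t z, (b z, x z))) (fun z :
  R * (B * H) => phi z.1 z.2.1 z.2.2)).
  by apply: continuous_at_pair; [exact: ct|apply: continuous_at_pair;
    [exact: cb|exact: cx]].
exact: phi_continuous.
Qed.

Let theta_continuousW (T : topologicalType) (t : T -> R) (b : T -> B) :
  continuous t -> continuous b -> continuous (fun z => theta (t z) (b z)).
Proof.
move=> ct cb z.
apply: (@continuous_comp _ _ _ (fun z => (t z, b z)) (fun z : R * B =>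
  theta z.1 z.2)).
  by apply: continuous_at_pair; [exact: ct|exact: cb].
exact: theta_continuous.
Qed.

Let integrand_loc_integrable t b :
  loc_integrable_vfun (fun u => phi (t - u) (theta u b) (f b u)).
Proof.
have [_ /(_ b)[mf nf] _ _ _] := affine.
apply: (loc_integrable_vfun_linear (L := fun u => phi (t - u) (theta u b))) => //.
  by move=> u; exact: phi_linear.
move=> x; apply: phi_continuousW; last exact: cst_continuous.
  by move=> u; apply: cvgB; [exact: cvg_cst|exact: cvg_id].
by apply: theta_continuousW; [move=> u; exact: cvg_id|exact: cst_continuous].
Qed.

(* The shift identity for [f] gives this for almost every [s] only; both sides
   are continuous in [s]. *)
Lemma inhD t s b : inh (t + s) b = inh t (theta s b) + phi t (theta s b) (inh s
  b).
Proof.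
pose P := [set s | inh (t + s) b - (inh t (theta s b) + phi t (theta s b) (inh
  s b)) = 0].
suff : P s by move=> /eqP; rewrite subr_eq0 => /eqP.
move: s; apply: ae_closed_setT.
  have idc : continuous (fun s : R => s) by move=> u; exact: cvg_id.
  have bc : continuous (fun _ : R => b) by exact: cst_continuous.
  have tc : continuous (fun _ : R => t) by exact: cst_continuous.
  pose g (s : R) := inh (t + s) b - (inh t (theta s b) + phi t (theta s b) (inh
    s b)).
  rewrite (_ : P = [set s | `|g s| = 0]); last first.
    by apply/seteqP; split => s; [move=> /= gs0; rewrite /g gs0 normr0|move=>
      /normr0_eq0].
  apply: closed_eq_continuous => s.
  apply: (@continuous_comp _ _ _ g); last exact: norm_continuous.
  apply: cvgB; first by apply: inh_continuous bc s => u; apply: cvgD;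
    [exact: cvg_cst|exact: cvg_id].
  have thc := theta_continuousW idc bc.
  apply: cvgD; first exact: inh_continuous.
  exact: (phi_continuousW tc thc (inh_continuous idc bc)).
have [_ _ /(_ b) hf _ _] := affine.
apply: lebesgue_ae_imply hf _ => s hs; rewrite /P/=; apply/eqP;
  rewrite subr_eq0; apply/eqP.
(* Variation of constants, with the integral cut at [s]. The piece from [s] to [t + s] is translated
   by [s] and turned into [inh t (theta s b)] by the shift identity; in the piece from 0 to [s] the
   map [phi t (theta s b)] is pulled out of the integral. *)
rewrite {1}/inhomogeneity (@ointegralD _ _ 0 s)//; rewrite addrC; congr (_ + _).
  have := ointegral_shift s 0 t (integrand_loc_integrable (t + s) b).
  rewrite add0r => ->.
  rewrite /inhomogeneity; apply: ae_eq_ointegral => //.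
    by move=> i; exact: (loc_integrable_shift s (integrand_loc_integrable (t +
      s) b i)).
  apply: lebesgue_ae_imply hs _ => u ->; rewrite -thetaD; congr phi.
  by ring.
rewrite /inhomogeneity -ointegral_linear//; last exact: phi_linear.
congr ointegral; apply/funext => u.
by rewrite -addrA [LHS]phiD -thetaD subrK.
Qed.

(** [is_affine_flow] prescribes a formula for [psi] and its continuity; that [psi] is a flow has to
    be derived, here from the cocycle identity [inhD]. *)
Lemma psiD t s b x : psi (t + s) b x = psi t (theta s b) (psi s b x).
Proof.
pose L := linear_of (phi_linear t (theta s b)).
rewrite !psiE phiD inhD -[phi t (theta s b)]/(L : H -> H) linearD.
by rewrite [inh _ _ + _]addrC addrA.
Qed.

Lemma inh0 b : inh 0 b = 0.
Proof.
have := inhD 0 0 b; rewrite addr0 theta0 phi0.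
by move=> /(congr1 (fun x => x - inh 0 b)); rewrite addrK subrr.
Qed.

Lemma psi0 b x : psi 0 b x = x.
Proof. by rewrite psiE phi0 inh0 addr0. Qed.

End affine_cocycle.

(** * Bounded orbits of a hyperbolic affine flow *)

Section direct_sum_projection.
Context (R : realType) (B : metricType R) (H : fdHilbertType R).
Context (U V : B -> {vspace H}).
Hypothesis UV : forall b, (U b + V b = fullv)%VS /\ (U b :&: V b = 0)%VS.
Local Notation pr := (fun b => daddv_pi (U b) (V b)).
Local Notation pr' := (fun b => daddv_pi (V b) (U b)).

Lemma direct_projE b x : pr b x + pr' b x = x.
Proof. by have [s i] := UV b; rewrite daddv_pi_add// s memvf. Qed.

Lemma direct_proj_unique b x u w : u \in U b -> w \in V b -> x = u + w ->
  pr b x = u.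
Proof.
move=> uU wV ->; have [_ i] := UV b; rewrite linearD/= daddv_pi_id//.
suff -> : pr b w = 0 by rewrite addr0.
have := direct_projE b w; rewrite [X in _ + X]daddv_pi_id// 1?capvC//.
by move=> /(congr1 (fun y => y - w)); rewrite addrK subrr.
Qed.

Hypothesis B_compact : compact [set: B].
Hypothesis closedU : closed (bundle_of U).
Hypothesis closedV : closed (bundle_of V).

(* The angle between the two bundles is bounded below, by compactness. *)
Lemma direct_proj_bounded : exists2 P : R, 0 < P & forall b x,
  `|pr b x| <= P * `|x|.
Proof.
(* After scaling the [U]-component to length 1, only a [V]-component of length at most 2 can nearly
   cancel it; the bound 2 makes [K] compact. *)
pose K := [set z : B * (H * H) | [/\ bundle_of U (z.1, z.2.1),
  bundle_of V (z.1, z.2.2), `|z.2.1| = 1 & `|z.2.2| <= 2]].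
have c1 : continuous (fun z : B * (H * H) => z.2.1).
  by move=> z; apply: continuous_comp; [exact: cvg_snd|exact: cvg_fst].
have c2 : continuous (fun z : B * (H * H) => z.2.2).
  by move=> z; apply: continuous_comp; [exact: cvg_snd|exact: cvg_snd].
have cK : compact K.
  apply: (@subclosed_compact _ _ ([set: B] `*` ([set x :
    H | `|x| <= 1] `*` [set x : H | `|x| <= 2]))).
  - rewrite (_ : K = ((fun z => (z.1, z.2.1)) @^-1` bundle_of U `&`
      (fun z => (z.1, z.2.2)) @^-1` bundle_of V) `&`
      ([set z | `|z.2.1| = 1] `&` [set z | `|z.2.2| <= 2])); last first.
      by apply/seteqP; split => z /=; [case|move=> [[? ?] [? ?]]; split].
    apply: closedI; apply: closedI.
    + apply: preimage_closed => // z _.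
      by apply: continuous_at_pair; [exact: cvg_fst|exact: c1].
    + apply: preimage_closed => // z _.
      by apply: continuous_at_pair; [exact: cvg_fst|exact: c2].
    + exact/closed_eq_continuous/continuous_norm.
    + exact/closed_le_continuous/continuous_norm.
  - by apply: compact_setX => //; apply: compact_setX;
    exact: compact_closed_ball0.
  - by move=> z [_ _ /= z1 z2]; split => //; split => //=; rewrite z1.
suff [m m0 hm] : exists2 m : R, 0 < m & forall z, K z -> m <= `|z.2.1 + z.2.2|.
  (* The summand [m^-1] serves the case where [x] rescales into [K]. The summand 1 serves a
     [V]-component more than twice as long as the [U]-component: then [x] is at least as long as the
     latter. *)
  exists (m^-1 + 1) => [|b x]; first by rewrite addr_gt0 ?invr_gt0.
  have [->|x0] := eqVneq (pr b x) 0; first by rewrite normr0 mulr_ge0//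
    addr_ge0// invr_ge0 ltW.
  have n0 : 0 < `|pr b x| by rewrite normr_gt0.
  have xE := direct_projE b x.
  rewrite mulrDl mul1r; have [le2|gt2] := leP `|pr' b x| (2 * `|pr b x|).
    rewrite (@le_trans _ _ (m^-1 * `|x|))// ?lerDl// ler_pdivlMl//.
    have /hm : K (b, (`|pr b x|^-1 *: pr b x, `|pr b x|^-1 *: pr' b x)).
      split => /=; rewrite ?/bundle_of/=.
      - by apply/memvZ/memv_pi.
      - by apply/memvZ/memv_pi.
      - by rewrite normrZ normfV normr_id mulVf// gt_eqF.
      - by rewrite normrZ normfV normr_id mulrC ler_pdivrMr.
    by rewrite /= -scalerDr xE normrZ normfV normr_id mulrC ler_pdivlMr.
  rewrite (@le_trans _ _ `|x|)// ?lerDr ?mulr_ge0 ?invr_ge0 ?(ltW m0)//.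
  have : `|pr' b x| <= `|x| + `|pr b x|.
    by rewrite -[X in `|X| <= _](addKr (pr b x)) xE addrC; exact: ler_normB.
  by move=> h; have := lt_le_trans gt2 h; rewrite mulr_natl mulr2n ltrD2r => /ltW.
have [K0|/set0P K0] := eqVneq K set0; first by exists 1 => // z; rewrite K0.
have [|z zK zmin] := compact_EVT_min (f := fun z : B * (H * H) =>
  `|z.2.1 + z.2.2|) K0 cK.
  apply: continuous_subspaceT => z.
  apply: (@continuous_comp _ _ _ (fun z : B * (H * H) => z.2.1 + z.2.2));
    last exact: norm_continuous.
  by apply: cvgD; [exact: c1|exact: c2].
exists `|z.2.1 + z.2.2| => [|y yK]; last by apply: zmin; rewrite inE.
rewrite normr_gt0; apply/eqP => s0; move: zK; rewrite inE => -[zU zV z1 _].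
have : z.2.1 \in (U z.1 :&: V z.1)%VS.
  rewrite memv_cap zU /=; move/eqP: s0; rewrite addr_eq0 => /eqP ->.
  by rewrite memvN.
rewrite (UV z.1).2 memv0 => /eqP z0; move: z1; rewrite z0 normr0 => /esym/eqP.
by rewrite oner_eq0.
Qed.

(** The subbundles come without local trivializations. But [u] is the projection of [x] exactly when
    [u] lies in [U b] and [x - u] in [V b]; so the graph is closed, and the bound on the projections
    confines its values locally to a compact ball. *)
Lemma direct_proj_continuous : continuous (fun z : B * H => pr z.1 z.2).
Proof.
have [P P0 hP] := direct_proj_bounded; move=> z0.
apply: (@closed_graph_continuous _ _ [set x : H | `|x| <= P * (`|z0.2| + 1)]).
- exact: compact_closed_ball0.
- have snd_cont : continuous (@snd B H) by move=> z; exact: cvg_snd.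
  have : nbhs z0 ((fun z : B * H => `|z.2|) @^-1` [set r | r < `|z0.2| + 1]).
    apply: (continuous_norm snd_cont); apply: open_nbhs_nbhs; split.
      exact: open_lt.
    by rewrite /= ltrDl.
  apply: filterS => z /= zlt; apply: le_trans (hP _ _) _.
  by rewrite ler_pM2l// ltW.
- rewrite (_ : [set _ | _] = (fun z : (B * H) * H => (z.1.1,
  z.2)) @^-1` bundle_of U `&`
     (fun z => (z.1.1, z.1.2 - z.2)) @^-1` bundle_of V); last first.
    apply/seteqP; split => -[[b x] u] /=; rewrite /bundle_of/=.
      move=> ->; split; first exact: memv_pi.
      by rewrite -{1}(direct_projE b x) addrAC subrr add0r memv_pi.
    by move=> [uU xV]; rewrite (direct_proj_unique uU xV)// addrC subrK.
  have c11 : continuous (fun z : (B * H) * H => z.1.1).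
    by move=> z; apply: continuous_comp; [exact: cvg_fst|exact: cvg_fst].
  have c12 : continuous (fun z : (B * H) * H => z.1.2).
    by move=> z; apply: continuous_comp; [exact: cvg_fst|exact: cvg_snd].
  apply: closedI; apply: preimage_closed => // z _.
  + by apply: (@continuous_at_pair _ _ _ (fun z : B * H * H => z.1.1) snd);
    [exact: c11|exact: cvg_snd].
  + apply: (@continuous_at_pair _ _ _ (fun z : B * H * H => z.1.1) (fun z =>
    z.1.2 - z.2)).
      exact: c11.
    by apply: cvgB; [exact: c12|exact: cvg_snd].
Qed.

End direct_sum_projection.

(** The bound is free of [C]: boundedness only serves to make the supremum S finite, and then S <= S
    / 2 + M. *)
Lemma half_contraction_bound (R : realType) (a : R -> R) (r M C : R) :
  (forall t, a t <= C) -> (forall t, a t <= a (t + r) / 2 + M) ->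
  forall t, a t <= 2 * M.
Proof.
move=> aC ah t.
have hs : has_sup (range a) by split; [exists (a 0), 0|exists C => _ [s _ <-]].
have : sup (range a) <= sup (range a) / 2 + M.
  apply: ge_sup; first exact: hs.1.
  move=> _ [s _ <-]; apply: le_trans (ah s) _; rewrite lerD2r ler_pM2r//.
  by apply: sup_upper_bound => //; exists (s + r).
have : a t <= sup (range a) by apply: sup_upper_bound => //; exists t.
lra.
Qed.

Section bounded_orbits.
Context (R : realType) (B : metricType R) (H : fdHilbertType R).
Hypothesis B_compact : compact [set: B].
Context (theta : R -> B -> B) (phi psi : R -> B -> H -> H) (f : B -> R -> H).
Hypothesis theta_flow : is_flow theta.
Hypothesis affine : is_affine_flow theta phi f psi.
Context (U1 U2 : B -> {vspace H}) (al K : R).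
Hypothesis closed1 : closed (bundle_of U1).
Hypothesis closed2 : closed (bundle_of U2).
Hypothesis U12 : forall b, (U1 b + U2 b = fullv)%VS /\ (U1 b :&: U2 b = 0)%VS.
Hypothesis invU : forall t b x, (x \in U1 b -> phi t b x \in U1 (theta t b)) /\
         (x \in U2 b -> phi t b x \in U2 (theta t b)).
Hypothesis al0 : 0 < al.
Hypothesis K0 : 0 < K.
Hypothesis stable : forall b t x, 0 <= t -> x \in U1 b ->
           `|phi t b x| <= K * expR (- al * t) * `|x|.
Hypothesis unstable : forall b t x, t <= 0 -> x \in U2 b ->
           `|phi t b x| <= K * expR (al * t) * `|x|.
Local Notation pi1 := (fun b => daddv_pi (U1 b) (U2 b)).
Local Notation pi2 := (fun b => daddv_pi (U2 b) (U1 b)).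
Local Notation inh := (inhomogeneity theta phi f).

Let phiDr t b x y : phi t b (x + y) = phi t b x + phi t b y.
Proof. exact: (linearD (linear_of (phi_linear affine t b))). Qed.

Let phiBr t b x y : phi t b (x - y) = phi t b x - phi t b y.
Proof. exact: (linearB (linear_of (phi_linear affine t b))). Qed.

Let U21 : forall b, (U2 b + U1 b = fullv)%VS /\ (U2 b :&: U1 b = 0)%VS.
Proof. by move=> b; rewrite addvC capvC. Qed.

Lemma pi1_phi t b x : pi1 (theta t b) (phi t b x) = phi t b (pi1 b x).
Proof.
apply: (direct_proj_unique U12 (w := phi t b (pi2 b x))).
- by have [+ _] := invU t b (pi1 b x); apply; exact: memv_pi.
- by have [_ +] := invU t b (pi2 b x); apply; exact: memv_pi.
- by rewrite -phiDr (direct_projE U12).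
Qed.

Lemma pi2_phi t b x : pi2 (theta t b) (phi t b x) = phi t b (pi2 b x).
Proof.
apply: (direct_proj_unique U21 (w := phi t b (pi1 b x))).
- by have [_ +] := invU t b (pi2 b x); apply; exact: memv_pi.
- by have [+ _] := invU t b (pi1 b x); apply; exact: memv_pi.
- by rewrite -phiDr (direct_projE U21).
Qed.

Lemma contraction_time (eta : R) : 0 < eta ->
  exists2 T : R, 0 < T & forall t, T <= t -> K * expR (- al * t) <= eta.
Proof.
move=> eta0; exists (K / eta / al) => [|t]; first by rewrite !divr_gt0.
rewrite ler_pdivrMr// => Kt.
rewrite mulNr expRN ler_pdivrMr ?expR_gt0// mulrC -ler_pdivrMr//.
apply: le_trans Kt _; rewrite mulrC; apply: le_trans (expR_ge1Dx _).
by rewrite lerDr.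
Qed.

(** Here [u] follows [phi] up to an error [M] over the times [T] and [- T]. The stable part is
    compared with its past, the unstable part with its future, so both are halved and each is at
    most [2 * (P * M)]. The difference of two bounded orbits has [M = 0], which gives uniqueness; a
    single orbit has as [M] a bound of [inh], which gives a bound common to all bounded orbits. *)
Let orbit_bound (T P M C : R) b (u : R -> H) :
  K * expR (- al * T) <= 1 / 2 -> 0 <= T ->
  (forall b x, `|pi1 b x| <= P * `|x|) -> (forall b x,
    `|pi2 b x| <= P * `|x|) -> 0 <= P ->
  (forall t, `|u t| <= C) ->
  (forall s, `|u (s + T) - phi T (theta s b) (u s)| <= M) ->
  (forall s, `|u (s - T) - phi (- T) (theta s b) (u s)| <= M) ->
  forall t, `|u t| <= 4 * (P * M).
Proof.
move=> hT T0 hP1 hP2 P0 uC u1 u2.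
have tD := thetaD theta_flow.
have a1 t : `|pi1 (theta t b) (u t)| <= `|pi1 (theta (t + - T) b) (u (t + -
  T))| / 2 + P * M.
  rewrite -{1}(subrK (phi T (theta (t - T) b) (u (t - T))) (u t)) linearD/= addrC.
  apply: le_trans (ler_normD _ _) _; apply: lerD; last first.
    by apply: le_trans (hP1 _ _) _; rewrite ler_wpM2l//; have := u1 (t - T);
      rewrite subrK.
  have -> : theta t b = theta T (theta (t - T) b) by rewrite -tD addrC subrK.
  rewrite pi1_phi.
  apply: le_trans (stable T0 (memv_pi _ _ _)) _.
  by rewrite mulrC ler_wpM2l//; move: hT; rewrite div1r.
have a2 t : `|pi2 (theta t b) (u t)| <= `|pi2 (theta (t + T) b) (u (t + T))| /
  2 + P * M.
  rewrite -{1}(subrK (phi (- T) (theta (t + T) b) (u (t + T))) (u t)) linearD/=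
    addrC.
  apply: le_trans (ler_normD _ _) _; apply: lerD; last first.
    by apply: le_trans (hP2 _ _) _; rewrite ler_wpM2l//; have := u2 (t + T);
      rewrite addrK.
  have -> : theta t b = theta (- T) (theta (t + T) b) by rewrite -tD addrC addrK.
  rewrite pi2_phi.
  apply: le_trans (unstable _ (memv_pi _ _ _)) _; first by rewrite oppr_le0.
  by rewrite mulrC ler_wpM2l//; move: hT; rewrite div1r mulrN mulNr.
have bd (p : B -> 'End(H)) : (forall b x, `|p b x| <= P * `|x|) -> forall t,
  `|p (theta t b) (u t)| <= P * C.
  by move=> hp t; apply: le_trans (hp _ _) _; rewrite ler_wpM2l.
move=> t; rewrite -(direct_projE U12 (theta t b) (u t)).
apply: le_trans (ler_normD _ _) _.
have := half_contraction_bound (bd _ hP1) a1 t.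
have := half_contraction_bound (bd _ hP2) a2 t.
lra.
Qed.

Lemma projections_bounded : exists P : R, [/\ 0 < P,
  forall b x, `|pi1 b x| <= P * `|x| & forall b x, `|pi2 b x| <= P * `|x|].
Proof.
have [P1 P10 h1] := direct_proj_bounded U12 B_compact closed1 closed2.
have [P2 P20 h2] := direct_proj_bounded U21 B_compact closed2 closed1.
exists (P1 + P2); split => [|b x|b x]; first exact: addr_gt0.
  by apply: le_trans (h1 b x) _; rewrite ler_wpM2r// lerDl ltW.
by apply: le_trans (h2 b x) _; rewrite ler_wpM2r// lerDr ltW.
Qed.

Lemma bounded_orbit_unique b x x' C C' : (forall t, `|psi t b x| <= C) ->
  (forall t, `|psi t b x'| <= C') -> x = x'.
Proof.
move=> xC xC'; have [P [P0 h1 h2]] := projections_bounded.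
have half0 : 0 < 1 / 2 :> R by rewrite divr_gt0.
have [T T0 hT] := contraction_time half0.
have uE t : psi t b x - psi t b x' = phi t b (x - x').
  by rewrite !(psiE affine) phiBr opprD addrACA subrr addr0.
have := @orbit_bound T P 0 (C + C') b (fun t =>
  psi t b x - psi t b x') (hT _ (lexx _)) (ltW T0) h1 h2 (ltW P0).
have uC t : `|psi t b x - psi t b x'| <= C + C'.
  by apply: le_trans (ler_normB _ _) _; exact: lerD.
have uD r s : `|psi (s + r) b x - psi (s + r) b x' - phi r (theta s b) (psi s b
  x - psi s b x')| <= 0.
  by rewrite !uE [s + r]addrC (phiD affine) subrr normr0.
move=> /(_ uC (uD T) (uD (- T)) 0); rewrite !mulr0 normr_le0 uE (phi0 affine).
by rewrite subr_eq0 => /eqP.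
Qed.

Lemma bounded_orbit_uniform : exists M : R, forall b x C,
  (forall t, `|psi t b x| <= C) -> forall t, `|psi t b x| <= M.
Proof.
have [P [P0 h1 h2]] := projections_bounded.
have half0 : 0 < 1 / 2 :> R by rewrite divr_gt0.
have [T T0 hT] := contraction_time half0.
have hM r : exists M : R, forall b, `|inh r b| <= M.
  have : compact ((fun b => psi r b 0) @` [set: B]).
    apply: continuous_compact => //; apply: continuous_subspaceT => b.
    apply: (@continuous_comp _ _ _ (fun b => (r, (b, 0))) (fun z :
      R * (B * H) => psi z.1 z.2.1 z.2.2)).
      by apply: continuous_at_pair; [exact: cvg_cst|apply: continuous_at_pair;
        [exact: cvg_id|exact: cvg_cst]].
    exact: (psi_continuous affine).
  move=> /compact_bounded[C [_ hC]]; exists (`|C| + 1) => b;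
    rewrite (inh_psi affine).
  by apply: hC; [rewrite (le_lt_trans (ler_norm _))// ltrDl|exists b].
have [M1 hM1] := hM T; have [M2 hM2] := hM (- T).
exists (4 * (P * Num.max M1 M2)) => b x C xC.
apply: (@orbit_bound T P _ C b (fun t =>
  psi t b x) (hT _ (lexx _)) (ltW T0) h1 h2 (ltW P0)) => // s.
  by rewrite [s + T]addrC (psiD theta_flow affine) (psiE affine) addrAC subrr
    add0r le_max hM1.
by rewrite [s - T]addrC (psiD theta_flow affine) (psiE affine) addrAC subrr
  add0r le_max hM2 orbT.
Qed.

Section bounded_section.
Context (e : B -> R -> H).
Hypothesis e_bounded : forall b, bounded_solution psi b (e b).

Let e_orbit b : exists C : R, forall t, `|psi t b (e b 0)| <= C.
Proof.
by have [eE [C eC]] := e_bounded b; exists C => t; rewrite -eE.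
Qed.

(** Both sides lie over [theta t b] and have bounded orbits, so uniqueness applies. *)
Lemma bounded_section_flow t b : psi t b (e b 0) = e (theta t b) 0.
Proof.
have [C hC] := e_orbit b; have [C' hC'] := e_orbit (theta t b).
apply: (bounded_orbit_unique _ hC') => s.
by rewrite -(psiD theta_flow affine); exact: hC.
Qed.

(* The graph is the set of points whose orbit obeys the uniform bound, which is
   closed. *)
Lemma bounded_section_continuous : continuous (fun b => e b 0).
Proof.
have [M hM] := bounded_orbit_uniform.
have eM b t : `|psi t b (e b 0)| <= M.
  by have [C hC] := e_orbit b; exact: hM hC t.
move=> b0; apply: (@closed_graph_continuous _ _ [set x : H | `|x| <= M]).
- exact: compact_closed_ball0.
- by apply: nearW => b /=; have := eM b 0; rewrite (psi0 theta_flow affine).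
- rewrite (_ : [set _ | _] = \bigcap_t [set z :
  B * H | `|psi t z.1 z.2| <= M]); last first.
    apply/seteqP; split => -[b x] /=; first by move=> -> t _; exact: eM.
    by move=> h; apply: (bounded_orbit_unique _ (eM b)) => t; exact: h.
  apply: closed_bigI => t _; apply: closed_le_continuous => z.
  apply: (@continuous_comp _ _ _ (fun z : B * H => psi t z.1 z.2));
    last exact: norm_continuous.
  apply: (@continuous_comp _ _ _ (fun z : B * H => (t, z)) (fun z :
    R * (B * H) => psi z.1 z.2.1 z.2.2)).
    by apply: continuous_at_pair; [exact: cvg_cst|exact: cvg_id].
  exact: (psi_continuous affine).
Qed.

End bounded_section.
End bounded_orbits.

(** * Chains and projective spaces *)

Section chain_dichotomy.
Context (R : realType) (X : pseudoMetricType R).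
Implicit Types (F : R -> X -> X) (eps T : R) (Z : set X) (g : X -> R).

Lemma le_chain F eps eps' T T' c : eps <= eps' -> T' <= T ->
  is_chain F eps T c -> is_chain F eps' T' c.
Proof.
move=> ee TT [n0 h]; split => // i /h[Ti bi]; split; first exact: le_trans Ti.
exact: le_ball bi.
Qed.

(* Large values of [g] are attracted to 1; a chain that is fine enough cannot
   escape. *)
Definition repelling F g :=
  [/\ forall x, 0 <= g x <= 1,
      forall eta, 0 < eta -> exists2 d, 0 < d & forall x y, ball x d y ->
        `|g x - g y| < eta &
      forall eta, 0 < eta -> exists2 T, 0 < T & forall t x, T <= t ->
        eta <= g x ->
        1 - eta <= g (F t x)].

(** The flow lifts a value of at least [eta] to at least [1 - eta], and the jump loses less than
    [eta]. As [eta <= 1 / 3], the result [1 - 2 * eta] is again at least [eta] and the step can be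
    repeated. *)
Lemma repelling_trap F g eta : repelling F g -> 0 < eta -> eta <= 1 / 3 ->
  exists d T, [/\ 0 < d, 0 < T & forall c i j, is_chain F d T c ->
    eta <= g (cpt c i) -> (i < j <= clen c)%N -> 1 - 2 * eta <= g (cpt c j)].
Proof.
move=> [_ ug rg] e0 e3; have [d d0 hd] := ug eta e0; have [T T0 hT] := rg eta e0.
exists d, T; split => // c i j [_ hc] gi.
elim: j => [//|j IHj] /andP[]; rewrite ltnS => ij jn.
have gj : eta <= g (cpt c j).
  move: ij; rewrite leq_eqVlt => /predU1P[<- //|ij].
  by have := IHj; rewrite ij ltnW// => /(_ isT); lra.
have [Tj bj] := hc j jn.
have := hd _ _ bj; have := hT _ _ Tj gj; rewrite ltr_norml => h /andP[_ h'].
by lra.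
Qed.

(** From a point of [Z] where [g] is positive, chains lead to every point of [Z]; the trap makes [g]
    arbitrarily close to 1 at their ends. *)
Lemma repelling_dichotomy F g Z : repelling F g -> chain_transitive F Z ->
  (forall x, Z x -> g x = 0) \/ (forall x, Z x -> g x = 1).
Proof.
move=> rg tZ; have [h|/existsNP[x /not_implyP[Zx gx]]] := pselect (forall x,
  Z x -> g x = 0).
  by left.
right=> y Zy; have [g01 _ _] := rg.
have gx0 : 0 < g x by rewrite lt_neqAle eq_sym (andP (g01 x)).1 andbT; exact/eqP.
apply/eqP; rewrite eq_le (andP (g01 y)).2 /=; apply/ler_addgt0Pr => e e0.
pose eta := Num.min (g x) (Num.min (1 / 3) (e / 2)).
have eta0 : 0 < eta by rewrite !lt_min gx0 !divr_gt0.
have [etax [eta3 etae]] : eta <= g x /\ eta <= 1 / 3 /\ eta <= e / 2.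
  by split; [|split]; rewrite /eta !ge_min lexx ?orbT.
have [d [T [d0 T0 trap]]] := repelling_trap rg eta0 eta3.
have [c [cc c0 cn]] := tZ x y Zx Zy d T d0 T0.
have := trap c 0%N (clen c) cc; rewrite c0 cn => /(_ etax).
by rewrite cc.1 leqnn => /(_ isT); lra.
Qed.

(** Controls the intermediate points of a chain, which may lie outside [Z]: the trap is entered at
    the initial point. *)
Lemma repelling_chain1 F g Z eta : repelling F g -> (forall x, Z x -> g x = 1) ->
  0 < eta -> eta <= 1 / 3 -> exists d T, [/\ 0 < d, 0 < T &
    forall c, is_chain F d T c -> Z (cpt c 0%N) ->
    forall i, (i <= clen c)%N -> 1 - 2 * eta <= g (cpt c i)].
Proof.
move=> rg gZ e0 e3; have [d [T [d0 T0 trap]]] := repelling_trap rg e0 e3.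
exists d, T; split => // c cc Z0 [_|i ic]; first by rewrite gZ//; lra.
by apply: (trap c 0%N) => //; rewrite gZ//; lra.
Qed.

(** A value above [eta] would be trapped and would keep [g] positive at the final point, which lies
    in [Z]. *)
Lemma repelling_chain0 F g Z eta : repelling F g -> (forall x, Z x -> g x = 0) ->
  0 < eta -> eta <= 1 / 3 -> exists d T, [/\ 0 < d, 0 < T &
    forall c, is_chain F d T c -> Z (cpt c (clen c)) ->
    forall i, (i <= clen c)%N -> g (cpt c i) <= eta].
Proof.
move=> rg gZ e0 e3; have [d [T [d0 T0 trap]]] := repelling_trap rg e0 e3.
exists d, T; split => // c cc Zn i ic; rewrite leNgt; apply/negP => gi.
move: ic; rewrite leq_eqVlt => /predU1P[ic|ic].
  by move: gi; rewrite ic gZ// => /(lt_trans e0); rewrite ltxx.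
by have := trap c i (clen c) cc (ltW gi); rewrite ic leqnn gZ// => /(_ isT); lra.
Qed.

End chain_dichotomy.

(** * Projective points and their unit representatives *)

Section projective_points.
Context (R : realType) (H : fdHilbertType R).
Implicit Types (x y u v : H) (p q : projspace H).

Lemma vline_scale k x : k != 0 -> <[k *: x]>%VS = <[x]>%VS.
Proof.
move=> k0; apply/eqP; rewrite eqEsubv -!memvE memvZ ?memv_line//=.
by rewrite -[X in X \in _](scalerK k0) memvZ// memv_line.
Qed.

Lemma projpt_eq x y (x0 : x != 0) (y0 : y != 0) k : y = k *: x ->
  projpt x0 = projpt y0.
Proof.
move=> yE; apply/val_inj => /=; rewrite yE vline_scale//.
by apply: contra_neq y0 => k0; rewrite yE k0 scale0r.
Qed.

Lemma projpt_inj x y (x0 : x != 0) (y0 : y != 0) : projpt x0 = projpt y0 ->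
  exists2 k, k != 0 & y = k *: x.
Proof.
move=> /(congr1 (fun p => pline p)) /= xy.
have /vlineP[k yE] : y \in <[x]>%VS by rewrite xy memv_line.
by exists k => //; apply: contra_neq y0 => k0; rewrite yE k0 scale0r.
Qed.

Lemma prep_projpt x (x0 : x != 0) : exists2 k, k != 0 & prep (projpt x0) = k *: x.
Proof. by apply: (@projpt_inj _ _ x0 (prep_neq0 _)); rewrite projptK. Qed.

(** A total form of [projpt], of the shape used in [projflow]; the default [d] is reached only at
    [x = 0]. *)
Definition mkproj (d : projspace H) x : projspace H := insubd d <[x]>%VS.

Lemma mkprojE d x (x0 : x != 0) : mkproj d x = projpt x0.
Proof. by apply/val_inj; rewrite /= val_insubd dim_vline x0. Qed.

Lemma mkprojZ d k x : k != 0 -> mkproj d (k *: x) = mkproj d x.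
Proof. by move=> k0; rewrite /mkproj vline_scale. Qed.

Lemma normalize_unit x : x != 0 -> `|normalize x| = 1.
Proof. by move=> x0; rewrite /normalize normrZ normfV normr_id mulVf
  ?normr_eq0. Qed.

Lemma unit_neq0 x : `|x| = 1 -> x != 0.
Proof. by move=> x1; rewrite -normr_eq0 x1 oner_eq0. Qed.

Lemma normalize_id x : `|x| = 1 -> normalize x = x.
Proof. by move=> x1; rewrite /normalize x1 invr1 scale1r. Qed.

Lemma projpt_normalize x (x0 : x != 0) :
  projpt x0 = projpt (unit_neq0 (normalize_unit x0)).
Proof. by apply: projpt_eq. Qed.

Lemma proj_unit p : exists u, exists u1 : `|u| = 1, p = projpt (unit_neq0 u1).
Proof.
exists (normalize (prep p)), (normalize_unit (prep_neq0 p)).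
by rewrite -projpt_normalize projptK.
Qed.

Lemma ball_projpt x y (x0 : x != 0) (y0 : y != 0) eps :
  `|normalize x - normalize y| < eps -> ball (projpt x0) eps (projpt y0).
Proof.
by move=> h; rewrite ballEmdist/= proj_distE; apply: le_lt_trans h;
  rewrite ge_min lexx.
Qed.

(** The metric is a minimum over the two signs, so one of the two unit representatives of [q] is
    close to [u] itself. *)
Lemma ball_proj_unit u (u1 : `|u| = 1) q eps :
  ball (projpt (unit_neq0 u1)) eps q ->
  exists v, exists v1 : `|v| = 1, q = projpt (unit_neq0 v1) /\ `|u - v| < eps.
Proof.
have [w [w1 ->]] := proj_unit q.
rewrite ballEmdist/= proj_distE !normalize_id// gt_min => /orP[h|h].
  by exists w, w1.
have w1' : `|- w| = 1 by rewrite normrN.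
exists (- w), w1'; rewrite opprK; split => //.
by apply: (@projpt_eq _ _ _ _ (-1)); rewrite scaleN1r.
Qed.

Lemma normalize_continuous x : x != 0 -> {for x, continuous (@normalize R H)}.
Proof.
move=> x0; apply: cvgZ; last exact: cvg_id.
by apply: cvgV; [rewrite normr_eq0|exact: norm_continuous].
Qed.

Lemma mkproj_continuous d x : x != 0 -> {for x, continuous (mkproj d)}.
Proof.
move=> x0 A /nbhs_ballP[e /= e0 eA].
have h1 : nbhs x [set y | y != 0].
  have : nbhs x (~` [set y : H | `|y| = 0]).
    apply: open_nbhs_nbhs; split; last by move=> /normr0_eq0 /eqP; exact/negP.
    by apply: closed_openC; exact/closed_eq_continuous/norm_continuous.
  by apply: filterS => y hy; apply/eqP => y0; apply: hy; rewrite /= y0 normr0.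
have h2 := normalize_continuous x0 (nbhsx_ballx (normalize x) _ e0).
apply: filterS2 h1 h2 => y y0 /= hy; apply: eA.
rewrite (mkprojE d x0) (mkprojE d y0); apply: ball_projpt.
by move: hy; rewrite -ball_normE.
Qed.

End projective_points.

Section projective_uniform_continuity.
Context (R : realType) (B : metricType R) (H : fdHilbertType R).
Hypothesis B_compact : compact [set: B].

(** Uniform continuity holds on the compact set of unit vectors in the cone [C]; homogeneity of
    degree 0 carries it to the projective bundle, where a nearby point has a nearby unit
    representative. It is applied to the ratios on the whole bundle and to the projection along the
    central line on [far]. *)
Lemma proj_uniform_continuous (Y : pseudoMetricType R) (C : set (B * H)) (G :
  B * H -> Y) :
  closed C -> (forall b x k, k != 0 -> C (b, x) -> C (b, k *: x)) ->
  (forall b x k, k != 0 -> G (b, k *: x) = G (b, x)) ->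
  (forall b x, x != 0 -> C (b, x) -> {for (b, x), continuous G}) ->
  forall eps, 0 < eps -> exists2 d, 0 < d & forall p q : B * projspace H,
    C (p.1, prep p.2) -> ball p d q ->
    ball (G (p.1, prep p.2)) eps (G (q.1, prep q.2)).
Proof.
move=> cC CZ GZ cG eps e0; pose K := C `&` [set z | `|z.2| = 1].
have cK : compact K.
  apply: (@subclosed_compact _ _ ([set: B] `*` [set x : H | `|x| <= 1])).
  - apply: closedI => //; apply: closed_eq_continuous;
    apply: continuous_norm => z.
    exact: cvg_snd.
  - by apply: compact_setX => //; exact: compact_closed_ball0.
  - by move=> z [_ /= ->].
have [|d d0 hd] := @compact_heine R _ _ K G cK _ eps e0.
  by move=> [b x] [Cz /= x1]; apply: cG => //; exact: unit_neq0.
exists d => // -[b p] [b' q] /=.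
have [u [u1 pE]] := proj_unit p => Cp [/= bb pq].
rewrite pE in pq; have [v [v1 [qE uv]]] := ball_proj_unit pq.
have GE c w (w0 : w != 0) r : r = projpt w0 -> G (c, prep r) = G (c, w).
  by move=> ->; have [k k0 ->] := prep_projpt w0; exact: GZ.
rewrite (GE _ _ _ _ pE) (GE _ _ _ _ qE); apply: hd; last first.
  by split => //=; rewrite -ball_normE.
split => //=; move: Cp; rewrite pE; have [k k0 ->] := prep_projpt (unit_neq0 u1).
by move=> h; rewrite -(scalerK k0 u); apply: CZ => //; rewrite invr_neq0.
Qed.

End projective_uniform_continuity.

Section hprod_theory.
Context (R : realType) (H : fdHilbertType R).
Implicit Types v : hprod H.

Lemma hprod_fst_le v : `|v.1| <= `|v|.
Proof.
rewrite hprod_normE -[leLHS]ger0_norm// -sqrtr_sqr ler_sqrt ?addr_ge0 ?sqr_ge0//.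
by rewrite lerDl sqr_ge0.
Qed.

Lemma hprod_snd_le v : `|v.2| <= `|v|.
Proof.
rewrite hprod_normE -sqrtr_sqr ler_sqrt ?addr_ge0 ?sqr_ge0//.
by rewrite lerDr sqr_ge0.
Qed.

Lemma hprod_norm_fst0 x : `|((x, 0) : hprod H)| = `|x|.
Proof. by rewrite hprod_normE /= expr0n/= addr0 sqrtr_sqr normr_id. Qed.

Lemma hprod_norm_le v : `|v| <= `|v.1| + `|v.2|.
Proof.
rewrite hprod_normE -[leRHS]ger0_norm ?addr_ge0// -sqrtr_sqr ler_sqrt ?sqr_ge0//.
by rewrite sqrrD real_normK ?num_real// -addrA lerD2l lerDr mulrn_wge0 ?mulr_ge0.
Qed.

(** The topology of [hprod H] is that of the Hilbert norm and not the product topology, so the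
    projections are continuous by a norm estimate. *)
Lemma hprod_fst_continuous : continuous (fun v : hprod H => v.1).
Proof.
move=> v A /nbhs_ballP[e /= e0 eA]; apply/nbhs_ballP; exists e => //= w.
rewrite -ball_normE /= => vw; apply: eA; rewrite -ball_normE /=.
by apply: le_lt_trans vw; exact: (hprod_fst_le (v - w)).
Qed.

Lemma hprod_snd_continuous : continuous (fun v : hprod H => v.2 : R).
Proof.
move=> v A /nbhs_ballP[e /= e0 eA]; apply/nbhs_ballP; exists e => //= w.
rewrite -ball_normE /= => vw; apply: eA.
by apply: le_lt_trans vw; exact: (hprod_snd_le (v - w)).
Qed.

End hprod_theory.

(** * The lifted flow *)

Section map_chain.
Context (R : realType) (X Y : pseudoMetricType R).

Definition map_chain (h : X -> Y) (c : chain R X) : chain R Y :=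
  Chain (clen c) (ctime c) (h \o cpt c).

Lemma map_chain_is_chain (F : R -> X -> X) (F' : R -> Y -> Y) (h : X ->
  Y) d eps T c :
  (forall t x, h (F t x) = F' t (h x)) ->
  (forall x y, ball x d y -> ball (h x) eps (h y)) ->
  is_chain F d T c -> is_chain F' eps T (map_chain h c).
Proof.
move=> hF hd [n0 cc]; split => // i ic.
by have [Ti bi] := cc i ic; split => //=; rewrite -hF; exact: hd.
Qed.

Lemma chain_transitive_image (F : R -> X -> X) (F' : R -> Y -> Y) (h : X ->
  Y) (Z : set X) :
  (forall t x, h (F t x) = F' t (h x)) ->
  (forall eps, 0 < eps -> exists2 d, 0 < d & forall x y, ball x d y ->
    ball (h x) eps (h y)) ->
  chain_transitive F Z -> chain_transitive F' (h @` Z).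
Proof.
move=> hF uh tZ _ _ [x Zx <-] [y Zy <-] eps T e0 T0.
have [d d0 hd] := uh eps e0; have [c [cc c0 cn]] := tZ x y Zx Zy d T d0 T0.
exists (map_chain h c); split; [|by rewrite /= c0|by rewrite /= cn].
exact: map_chain_is_chain cc.
Qed.

End map_chain.

Section projective_flow.
Context (R : realType) (B : metricType R) (H : fdHilbertType R).
Context (theta : R -> B -> B) (phi : R -> B -> H -> H).

Lemma projflowE t b x (x0 : x != 0) (y0 : phi t b x != 0) : linear (phi t b) ->
  projflow theta phi t (b, projpt x0) = (theta t b, projpt y0).
Proof.
move=> lin; rewrite /projflow/=; congr (_, _); have [k k0 ->] := prep_projpt x0.
rewrite -[phi t b]/(linear_of lin : H -> H) linearZ/= vline_scale//.
exact: mkprojE.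
Qed.

End projective_flow.

Section infinity.
Context (R : realType) (H : fdHilbertType R).

Lemma inf_neq0 (x : H) : x != 0 -> ((x, 0) : hprod H) != 0.
Proof. by move=> x0; apply: contra_neq x0 => -[]. Qed.

Definition inf_proj (p : projspace H) : projspace (hprod H) :=
  projpt (inf_neq0 (prep_neq0 p)).

Lemma inf_projE (x : H) (x0 : x != 0) : inf_proj (projpt x0) = projpt (inf_neq0
  x0).
Proof.
have [k k0 kE] := prep_projpt x0; apply/esym/(@projpt_eq _ _ _ _ _ _ k).
by rewrite kE; congr pair; rewrite scaler0.
Qed.

Lemma normalize_inf (x : H) : normalize ((x, 0) : hprod H) = (normalize x, 0).
Proof. by rewrite /normalize hprod_norm_fst0; congr pair; rewrite scaler0. Qed.

Lemma mdist_inf_proj (p q : projspace H) :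
  mdist (inf_proj p) (inf_proj q) = mdist p q.
Proof.
rewrite -[in RHS](projptK (prep_neq0 p)) -[in RHS](projptK (prep_neq0 q)).
rewrite /inf_proj !proj_distE !normalize_inf.
have E (x y : H) : ((x, 0) : hprod H) + (y, 0) = (x + y, 0) by congr pair;
  rewrite addr0.
have E' (x y : H) : ((x, 0) : hprod H) - (y, 0) = (x - y, 0) by congr pair;
  rewrite subr0.
by rewrite E E' !hprod_norm_fst0.
Qed.

Lemma inf_proj_inj : injective inf_proj.
Proof.
by move=> p q pq; apply: mdist_positivity; rewrite -mdist_inf_proj pq mdistxx.
Qed.

Lemma ball_inf_proj p eps q : ball (inf_proj p) eps (inf_proj q) <-> ball p eps q.
Proof. by rewrite !ballEmdist/= mdist_inf_proj. Qed.

End infinity.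

Section ratio_growth.
Context (R : realType) (a c r a' c' k eta : R).
Hypotheses (a0 : 0 <= a) (c0 : 0 <= c) (r0 : 0 <= r) (a'0 : 0 <= a') (c'0 :
  0 <= c').
Hypotheses (s0 : 0 < a + c + r) (s'0 : 0 < a' + c' + r).
Hypotheses (k1 : k <= 1) (eta0 : 0 < eta) (keta : k <= eta ^+ 2).
Hypotheses (aa : a' <= k * a) (cc : c <= k * c').

(** One factor [eta] of [k <= eta ^+ 2] cancels against the ratio:
    [eta * (a + c + r) <= c <= eta ^+ 2 * c']. The other makes [a' + r <= a + c + r] at most
    [eta * c']. *)
Lemma ratio_growth2 : eta <= c / (a + c + r) -> 1 - eta <= c' / (a' + c' + r).
Proof.
rewrite ler_pdivlMr// ler_pdivlMr// => h.
have [e1|e1] := leP 1 eta.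
  by apply: le_trans c'0; rewrite mulr_le0_ge0 ?subr_le0// ltW.
have h1 : a + c + r <= eta * c'.
  rewrite -(ler_pM2l eta0) mulrA -expr2; apply: le_trans h _;
    apply: le_trans cc _.
  exact: ler_wpM2r.
have h2 : a' <= a by apply: le_trans aa _; rewrite ler_piMl.
have h3 : 0 <= eta * (a' + r) by rewrite mulr_ge0 ?addr_ge0// ltW.
nra.
Qed.

(** Since [r] does not grow, the decay of the stable part does the work:
    [eta * a <= c + r <= c' + r], hence [a' <= eta ^+ 2 * a <= eta * (c' + r)]. *)
Lemma ratio_growth1 : eta <= (c + r) / (a + c + r) ->
  1 - eta <= (c' + r) / (a' + c' + r).
Proof.
rewrite ler_pdivlMr// ler_pdivlMr// => h.
have [e1|e1] := leP 1 eta.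
  by apply: le_trans (addr_ge0 c'0 r0); rewrite mulr_le0_ge0 ?subr_le0// ltW.
have h2 : c <= c' by apply: le_trans cc _; rewrite ler_piMl.
have h1 : eta * a <= c' + r.
  have : 0 <= eta * (c + r) by rewrite mulr_ge0 ?addr_ge0// ltW.
  by move: h; rewrite -addrA mulrDr; lra.
have h4 : a' <= eta * (c' + r).
  apply: le_trans aa _; apply: le_trans (_ : eta ^+ 2 * a <= _);
    first exact: ler_wpM2r.
  by rewrite expr2 -mulrA ler_pM2l.
have h3 : 0 <= eta * a' by rewrite mulr_ge0// ltW.
nra.
Qed.

End ratio_growth.

Section affine_points.
Context (R : realType) (H : fdHilbertType R).

Let one_le (x : H) : 1 <= `|((x, 1) : hprod H)|.
Proof. by have := hprod_snd_le ((x, 1) : hprod H); rewrite normr1. Qed.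

Let normalize_lipschitz (u v : hprod H) : 1 <= `|u| -> 1 <= `|v| ->
  `|normalize u - normalize v| <= 2 * `|u - v|.
Proof.
move=> u1 v1; have u0 : 0 < `|u| by exact: lt_le_trans u1.
have v0 : 0 < `|v| by exact: lt_le_trans v1.
have -> : normalize u - normalize v = `|u|^-1 *: (u - v) + (`|u|^-1 - `|v|^-1)
  *: v.
  by rewrite /normalize scalerBr scalerBl addrA subrK.
have ui : `|u|^-1 <= 1 by rewrite invf_le1.
have h1 : `| `|u|^-1 *: (u - v)| <= `|u - v|.
  by rewrite normrZ normfV normr_id ler_piMl.
have h2 : `|(`|u|^-1 - `|v|^-1) *: v| <= `|u - v|.
  rewrite normrZ -[X in _ * X](normr_id v) -normrM.
  have -> : (`|u|^-1 - `|v|^-1) * `|v| = `|u|^-1 * (`|v| - `|u|).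
    by rewrite mulrBl mulVf ?gt_eqF// mulrBr mulVf ?gt_eqF.
  rewrite normrM normfV normr_id; apply: le_trans (_ : `| `|v| - `|u| | <= _).
    by rewrite ler_piMl.
  by rewrite distrC; exact: ler_dist_dist.
by apply: le_trans (ler_normD _ _) _; rewrite mulr_natl mulr2n; exact: lerD.
Qed.

(** The vectors [(x, 1)] have norm at least 1, and there normalization is Lipschitz with constant
    2. *)
Lemma ball_affine_pt (x y : H) eps : ball x (eps / 2) y ->
  ball (affine_pt x) eps (affine_pt y).
Proof.
rewrite -ball_normE /= => xy; apply: ball_projpt.
apply: le_lt_trans (normalize_lipschitz (one_le x) (one_le y)) _.
apply: le_lt_trans (_ : 2 * `|x - y| < _); last by rewrite mulrC -ltr_pdivlMr.
rewrite ler_pM2l//; apply: le_trans (hprod_norm_le _) _.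
by rewrite /= subrr normr0 addr0.
Qed.

End affine_points.

(** * Chain transitive sets of the lift, given a continuous invariant section [E] *)

Section lifted_flow.
Context (R : realType) (B : metricType R) (H : fdHilbertType R).
Hypothesis B_compact : compact [set: B].
Context (theta : R -> B -> B) (phi psi : R -> B -> H -> H) (f : B -> R -> H).
Hypothesis theta_flow : is_flow theta.
Hypothesis affine : is_affine_flow theta phi f psi.
Context (U1 U2 : B -> {vspace H}) (al K : R).
Hypothesis closed1 : closed (bundle_of U1).
Hypothesis closed2 : closed (bundle_of U2).
Hypothesis U12 : forall b, (U1 b + U2 b = fullv)%VS /\ (U1 b :&: U2 b = 0)%VS.
Hypothesis invU : forall t b x, (x \in U1 b -> phi t b x \in U1 (theta t b)) /\
         (x \in U2 b -> phi t b x \in U2 (theta t b)).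
Hypothesis al0 : 0 < al.
Hypothesis K0 : 0 < K.
Hypothesis stable : forall b t x, 0 <= t -> x \in U1 b ->
           `|phi t b x| <= K * expR (- al * t) * `|x|.
Hypothesis unstable : forall b t x, t <= 0 -> x \in U2 b ->
           `|phi t b x| <= K * expR (al * t) * `|x|.
Context (E : B -> H).
Hypothesis E_continuous : continuous E.
Hypothesis E_flow : forall t b, psi t b (E b) = E (theta t b).
Local Notation pi1 := (fun b => daddv_pi (U1 b) (U2 b)).
Local Notation pi2 := (fun b => daddv_pi (U2 b) (U1 b)).
Local Notation inh := (inhomogeneity theta phi f).
Local Notation phi1 := (affine_lift theta phi f).
Local Notation F0 := (projflow theta phi).
Local Notation F1 := (projflow theta phi1).

Let phi0r t b : phi t b 0 = 0.
Proof. exact: (linear0 (linear_of (phi_linear affine t b))). Qed.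

Lemma phi_neq0 t b x : x != 0 -> phi t b x != 0.
Proof.
apply: contra_neq => px0.
have := phiD affine (- t) t b x; rewrite addNr (phi0 affine) px0 => ->.
exact: phi0r.
Qed.

Lemma affine_lift_linear t b : linear (phi1 t b).
Proof.
move=> k v w; rewrite /affine_lift; congr pair => /=.
have -> : (k *: v.2 + w.2) *: inh t b = k *: (v.2 *: inh t b) + w.2 *: inh t b.
  by rewrite scalerA -scalerDl.
by rewrite (phi_linear affine) scalerDr addrACA.
Qed.

Lemma affine_lift_neq0 t b v : v != 0 -> phi1 t b v != 0.
Proof.
case: v => x r; apply: contra_neq => -[/= h r0]; move: h;
  rewrite r0 scale0r addr0.
by move=> h; congr pair; apply/eqP; apply: contraTT (eqxx (phi t b x)) =>
  /(phi_neq0 t b); rewrite h eqxx.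
Qed.

(* The fiber coordinate in which the bounded line bundle is the zero section. *)
Definition line_coord b (v : hprod H) : H := v.1 - v.2 *: E b.

Lemma line_coord_flow t b v : line_coord (theta t b) (phi1 t b v) = phi t b
  (line_coord b v).
Proof.
have -> : phi t b (line_coord b v) = phi t b v.1 - v.2 *: phi t b (E b).
  rewrite /line_coord -[phi t b]/(linear_of (phi_linear affine t b) : H -> H).
  by rewrite linearB; congr (_ - _); rewrite linearZ.
rewrite /line_coord /affine_lift/= -E_flow (psiE affine) scalerDr.
by rewrite opprD addrACA subrr addr0.
Qed.

Lemma line_coordZ b k v : line_coord b (k *: v) = k *: line_coord b v.
Proof. by rewrite /line_coord/= scalerBr scalerA. Qed.

Lemma line_coord_continuous : continuous (fun z : B * hprod H =>
  line_coord z.1 z.2).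
Proof.
move=> z; apply: cvgB.
  by apply: (@continuous_comp _ _ _ snd (fun v : hprod H => v.1));
    [exact: cvg_snd|exact: hprod_fst_continuous].
apply: cvgZ.
  by apply: (@continuous_comp _ _ _ snd (fun v : hprod H => v.2 : R));
    [exact: cvg_snd|exact: hprod_snd_continuous].
by apply: (@continuous_comp _ _ _ fst E); [exact: cvg_fst|exact: E_continuous].
Qed.

(* Sizes of the stable, unstable and central parts of a vector. The ratios [G2]
   and [G1] below are those which the flow repels from 0. *)
Let a (z : B * hprod H) : R := `|pi1 z.1 (line_coord z.1 z.2)|.
Let c (z : B * hprod H) : R := `|pi2 z.1 (line_coord z.1 z.2)|.
Let r (z : B * hprod H) : R := `|z.2.2 : R|.
Let s z := a z + c z + r z.

Let a_ge0 z : 0 <= a z. Proof. exact: normr_ge0. Qed.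
Let c_ge0 z : 0 <= c z. Proof. exact: normr_ge0. Qed.
Let r_ge0 z : 0 <= r z. Proof. exact: normr_ge0. Qed.

Let U21 : forall b, (U2 b + U1 b = fullv)%VS /\ (U2 b :&: U1 b = 0)%VS.
Proof. by move=> b; rewrite addvC capvC. Qed.

Let line_coord_pair : continuous (fun z : B * hprod H => (z.1,
  line_coord z.1 z.2)).
Proof.
by move=> z; apply: continuous_at_pair; [exact: cvg_fst|exact:
  line_coord_continuous].
Qed.

Let a_cont : continuous a.
Proof.
apply: continuous_norm => z; apply: (@continuous_comp _ _ _
  (fun z : B * hprod H => (z.1, line_coord z.1 z.2)) (fun z : B * H =>
    pi1 z.1 z.2)).
  exact: line_coord_pair.
exact: direct_proj_continuous.
Qed.

Let c_cont : continuous c.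
Proof.
apply: continuous_norm => z; apply: (@continuous_comp _ _ _
  (fun z : B * hprod H => (z.1, line_coord z.1 z.2)) (fun z : B * H =>
    pi2 z.1 z.2)).
  exact: line_coord_pair.
exact: (direct_proj_continuous U21).
Qed.

Let r_cont : continuous r.
Proof.
apply: continuous_norm => z; apply: (@continuous_comp _ _ _ snd (fun v :
  hprod H => v.2 : R)).
  exact: cvg_snd.
exact: hprod_snd_continuous.
Qed.

Let aZ b k v : a (b, k *: v) = `|k| * a (b, v).
Proof. by rewrite /a/= line_coordZ linearZ normrZ. Qed.
Let cZ b k v : c (b, k *: v) = `|k| * c (b, v).
Proof. by rewrite /c/= line_coordZ linearZ normrZ. Qed.
Let rZ b k v : r (b, k *: v) = `|k| * r (b, v).
Proof. by rewrite /r/= normrM. Qed.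

Let line_coord_eq0 z : a z = 0 -> c z = 0 -> line_coord z.1 z.2 = 0.
Proof.
move=> /normr0_eq0 a0 /normr0_eq0 c0.
by rewrite -(direct_projE U12 z.1 (line_coord z.1 z.2)) a0 c0 addr0.
Qed.

Let hprod_eq0 b v : line_coord b v = 0 -> v.2 = 0 -> v = 0.
Proof.
by case: v => x q; rewrite /line_coord /= => h q0; move: h;
  rewrite q0 scale0r subr0 => ->.
Qed.

Let s_gt0 b v : v != 0 -> 0 < s (b, v).
Proof.
move=> v0; rewrite lt_neqAle addr_ge0 ?addr_ge0// andbT eq_sym.
apply: contra_neq v0; rewrite /s => /eqP.
rewrite paddr_eq0 ?addr_ge0// paddr_eq0// =>
  /andP[/andP[/eqP a0 /eqP c0] /eqP r0].
by apply: (@hprod_eq0 b); [exact: (line_coord_eq0 a0 c0)|exact: normr0_eq0].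
Qed.

Let G2 z := c z / s z.
Let G1 z := (c z + r z) / s z.

Let s_cont : continuous s.
Proof. by move=> z; apply: cvgD; [apply: cvgD;
  [exact: a_cont|exact: c_cont]|exact: r_cont]. Qed.

Let G2_cont b v : v != 0 -> {for (b, v), continuous G2}.
Proof.
move=> v0; apply: cvgM; first exact: c_cont.
by apply: cvgV; [rewrite gt_eqF// s_gt0|exact: s_cont].
Qed.

Let G1_cont b v : v != 0 -> {for (b, v), continuous G1}.
Proof.
move=> v0; apply: cvgM; first by apply: cvgD; [exact: c_cont|exact: r_cont].
by apply: cvgV; [rewrite gt_eqF// s_gt0|exact: s_cont].
Qed.

Let G2Z b v k : k != 0 -> G2 (b, k *: v) = G2 (b, v).
Proof.
move=> k0; rewrite /G2 /s aZ cZ rZ -!mulrDr invfM mulrACA divff ?mul1r//.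
by rewrite normr_eq0.
Qed.

Let G1Z b v k : k != 0 -> G1 (b, k *: v) = G1 (b, v).
Proof.
move=> k0; rewrite /G1 /s aZ cZ rZ -!mulrDr invfM mulrACA divff ?mul1r//.
by rewrite normr_eq0.
Qed.

(** [prep] picks an unknown multiple of the image vector; a function of degree 0 does not see
    which. *)
Let flow_prep (Y : Type) (G : B * hprod H -> Y) :
  (forall b v k, k != 0 -> G (b, k *: v) = G (b, v)) -> forall t q,
  G ((F1 t q).1, prep (F1 t q).2) = G (theta t q.1, phi1 t q.1 (prep q.2)).
Proof.
move=> GZ t [b p] /=; have v0 := prep_neq0 p.
have := projflowE theta v0 (affine_lift_neq0 t b v0) (affine_lift_linear t b).
rewrite projptK => [[->]].
by have [k k0 ->] := prep_projpt (affine_lift_neq0 t b v0); exact: GZ.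
Qed.

Let contract b v t (k : R) : 0 <= t -> K * expR (- al * t) <= k ->
  a (theta t b, phi1 t b v) <= k * a (b, v) /\ c (b, v) <= k * c (theta t b,
    phi1 t b v).
Proof.
move=> t0 kt; rewrite /a /c /= line_coord_flow (pi1_phi affine U12 invU)
  (pi2_phi affine U12 invU); split.
  by apply: le_trans (stable t0 (memv_pi _ _ _)) _; exact: ler_wpM2r.
set w := pi2 b _.
(* The unstable estimate holds for negative times, so it is applied over [theta t b] to go back to
   [b]. The rewriting also hits [w] on the right-hand side, where the next line restores it. *)
have -> : w = phi (- t) (theta t b) (phi t b w) by rewrite -(phiD affine) addNr
  (phi0 affine).
rewrite [X in _ <= _ * `|phi t b X|](_ : _ = w);
  last by rewrite -(phiD affine) addNr (phi0 affine).
apply: le_trans (unstable _ _) _.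
- by rewrite oppr_le0.
- by have [_ +] := invU t b w; apply; exact: memv_pi.
- by rewrite ler_wpM2r//; move: kt; rewrite mulrN mulNr.
Qed.

Let growth (G : B * hprod H -> R) :
  (forall b v k, k != 0 -> G (b, k *: v) = G (b, v)) ->
  (forall z z' k eta, 0 < s z -> 0 < s z' -> k <= 1 -> 0 < eta -> k <= eta ^+ 2 ->
     a z' <= k * a z -> c z <= k * c z' -> r z' = r z -> eta <= G z ->
       1 - eta <= G z') ->
  forall eta, 0 < eta -> exists2 T, 0 < T & forall t q, T <= t ->
    eta <= G (q.1, prep q.2) -> 1 - eta <= G ((F1 t q).1, prep (F1 t q).2).
Proof.
move=> GZ hG eta eta0; pose k := Num.min 1 (eta ^+ 2).
have k0 : 0 < k by rewrite lt_min ltr01 exprn_gt0.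
have [T T0 hT] := contraction_time al0 K0 k0.
exists T => // t [b p] Tt; rewrite (flow_prep GZ) /= => h.
have [h1 h2] := contract b (prep p) (le_trans (ltW T0) Tt) (hT t Tt).
apply: (hG (b, prep p) _ k) => //.
- by rewrite s_gt0// prep_neq0.
- by rewrite s_gt0// affine_lift_neq0// prep_neq0.
- by rewrite ge_min lexx.
- by rewrite ge_min lexx orbT.
Qed.

Let unif (G : B * hprod H -> R) :
  (forall b v k, k != 0 -> G (b, k *: v) = G (b, v)) ->
  (forall b v, v != 0 -> {for (b, v), continuous G}) ->
  forall eta, 0 < eta -> exists2 d, 0 < d & forall p q : B * projspace (hprod H),
    ball p d q -> `|G (p.1, prep p.2) - G (q.1, prep q.2)| < eta.
Proof.
move=> GZ Gc eta eta0.
have [||d d0 hd] := @proj_uniform_continuous R B (hprod H) B_compact R setT G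
  closedT _ GZ _ eta eta0.
- by [].
- by move=> b x x0 _; exact: Gc.
- by exists d => // p q pq; exact: hd.
Qed.

Let repelling2 : repelling F1 (fun q => G2 (q.1, prep q.2)).
Proof.
split.
- move=> [b p] /=; have s0 := s_gt0 b (prep_neq0 p).
  rewrite /G2 divr_ge0 ?(ltW s0)//= ler_pdivrMr// mul1r /s.
  by rewrite addrAC lerDr addr_ge0.
- exact: unif G2Z G2_cont.
- apply: (growth G2Z) => z z' k eta s0 s'0 k1 e0 ke aa cc rr; rewrite /G2 /s rr.
  by apply: (@ratio_growth2 _ _ _ _ _ _ k) => //; move: s'0; rewrite /s rr.
Qed.

Let repelling1 : repelling F1 (fun q => G1 (q.1, prep q.2)).
Proof.
split.
- move=> [b p] /=; have s0 := s_gt0 b (prep_neq0 p).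
  rewrite /G1 divr_ge0 ?(ltW s0) ?addr_ge0//= ler_pdivrMr// mul1r /s.
  by rewrite -addrA lerDr.
- exact: unif G1Z G1_cont.
- apply: (growth G1Z) => z z' k eta s0 s'0 k1 e0 ke aa cc rr; rewrite /G1 /s rr.
  by apply: (@ratio_growth1 _ _ _ _ _ _ k) => //; move: s'0; rewrite /s rr.
Qed.

(** A closed cone that contains the vectors at infinity, where [r = 0], and whose only vectors on
    the central line are zero, as [a = c = 0] there. *)
Let far : set (B * hprod H) := [set z | r z <= a z + c z].

(** The clause on fine chains serves the projection to infinity, which is uniformly continuous on
    [far] only. *)
Lemma lift_chain_transitive_cases (Z : set (B * projspace (hprod H))) :
  chain_transitive F1 Z ->
  (forall q, Z q -> line_coord q.1 (prep q.2) = 0) \/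
  (forall q, Z q -> (prep q.2).2 = 0) /\
  exists d T, [/\ 0 < d, 0 < T & forall c, is_chain F1 d T c -> Z (cpt c 0%N) ->
    Z (cpt c (clen c)) -> forall i, (i <= clen c)%N ->
    far ((cpt c i).1, prep (cpt c i).2)].
Proof.
move=> tZ.
have sq (q : B * projspace (hprod H)) : 0 < s (q.1,
  prep q.2) by rewrite s_gt0// prep_neq0.
(* With [eta = 1 / 4] the points of fine chains satisfy [G2 >= 1 / 2] or [G1 <= 1 / 4]; either
   inequality implies [r <= a + c]. *)
have e0 : 0 < 1 / 4 :> R by rewrite divr_gt0.
have e3 : 1 / 4 <= 1 / 3 :> R by lra.
have [h2|h2] := repelling_dichotomy repelling2 tZ; last first.
  right; split.
    move=> q /h2; have := sq q; set z := (q.1, prep q.2) => s0 G2z.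
    have : c z = s z by rewrite -[RHS]mul1r -G2z divfK// gt_eqF.
    rewrite /s => h.
    apply: normr0_eq0; apply/eqP; rewrite eq_le normr_ge0 andbT.
    by have := a_ge0 z; have := r_ge0 z; rewrite /r /z/=; move: h;
      rewrite /r/=; lra.
  have [d [T [d0 T0 h]]] := repelling_chain1 repelling2 h2 e0 e3.
  exists d, T; split => // ch cc Z0 _ i ic; have := h ch cc Z0 i ic.
  have := sq (cpt ch i); set z := (_, _) => s0.
  rewrite /G2 ler_pdivlMr// /s /far /= => h'.
  have := a_ge0 z; have := r_ge0 z; lra.
have [h1|h1] := repelling_dichotomy repelling1 tZ.
  right; split.
    move=> q /h1; have := sq q; set z := (q.1, prep q.2) => s0 /eqP.
    rewrite /G1 mulf_eq0 invr_eq0 [s _ == 0]gt_eqF// orbF paddr_eq0// => /andP[_].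
    by rewrite normr_eq0 => /eqP.
  have [d [T [d0 T0 h]]] := repelling_chain0 repelling1 h1 e0 e3.
  exists d, T; split => // ch cc _ Zn i ic; have := h ch cc Zn i ic.
  have := sq (cpt ch i); set z := (_, _) => s0.
  rewrite /G1 ler_pdivrMr// /s /far /= => h'.
  have := a_ge0 z; have := c_ge0 z; have := r_ge0 z; lra.
left=> q Zq; have := h1 q Zq; have := h2 q Zq; have := sq q.
set z := (q.1, prep q.2) => s0 /eqP.
rewrite /G2 mulf_eq0 invr_eq0 [s _ == 0]gt_eqF// orbF => /eqP c0 G1z.
have : c z + r z = s z by rewrite -[RHS]mul1r -G1z divfK// gt_eqF.
rewrite /s c0 addr0 add0r => h.
by apply: (line_coord_eq0 (z := z)) => //; move: h; lra.
Qed.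

Definition inf_embed (q : B * projspace H) : B * projspace (hprod H) := (q.1,
  inf_proj q.2).

Lemma inf_embed_flow t q : inf_embed (F0 t q) = F1 t (inf_embed q).
Proof.
case: q => b p; rewrite -(projptK (prep_neq0 p)).
have x0 := prep_neq0 p; move: (prep p) (prep_neq0 p) x0 => x x0 _.
rewrite /inf_embed/= inf_projE.
have := projflowE theta (inf_neq0 x0) (affine_lift_neq0 t b (inf_neq0 x0))
  (affine_lift_linear t b).
move=> ->.
have := projflowE theta x0 (phi_neq0 t b x0) (phi_linear affine t b).
move=> [->]; congr pair; rewrite inf_projE.
by apply: (@projpt_eq _ _ _ _ _ _ 1); rewrite scale1r /affine_lift/= scale0r
  addr0.
Qed.

Lemma inf_embed_inj : injective inf_embed.
Proof.
move=> [b p] [b' p'] h; have /= -> := congr1 fst h.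
by have /inf_proj_inj /= -> := congr1 snd h.
Qed.

Lemma ball_inf_embed p eps q : ball (inf_embed p) eps (inf_embed q) <->
  ball p eps q.
Proof. by split=> -[/= h1 /ball_inf_proj h2]; split. Qed.

Lemma inf_embedP q : range inf_embed q <-> (prep q.2).2 = 0.
Proof.
split=> [[[b p] _ <-] /=|].
  by rewrite /inf_proj; have [k k0 ->] := prep_projpt (inf_neq0 (prep_neq0 p));
    rewrite /= scaler0.
case: q => b p /= p2.
have pE : prep p = ((prep p).1, 0) by rewrite -p2 -surjective_pairing.
have x0 : (prep p).1 != 0 by apply: contra_neq (prep_neq0 p) => x0; rewrite pE x0.
exists (b, projpt x0) => //; rewrite /inf_embed/= inf_projE; congr pair.
rewrite -[RHS](projptK (prep_neq0 p)).
by apply: (@projpt_eq _ _ _ _ _ _ 1); rewrite scale1r.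
Qed.

Lemma chain_transitive_inf_embed Z : chain_transitive F0 Z ->
  chain_transitive F1 (inf_embed @` Z).
Proof.
apply: chain_transitive_image; first exact: inf_embed_flow.
by move=> eps e0; exists eps => // p q /ball_inf_embed.
Qed.

Let far_closed : closed far.
Proof.
rewrite (_ : far = [set z | r z - (a z + c z) <= 0]); last first.
  by apply/seteqP; split => z; rewrite /far /= subr_le0.
apply: closed_le_continuous => z; apply: cvgB; first exact: r_cont.
by apply: cvgD; [exact: a_cont|exact: c_cont].
Qed.

Let farZ b v k : k != 0 -> far (b, v) -> far (b, k *: v).
Proof. by move=> k0; rewrite /far /= aZ cZ rZ -mulrDr ler_pM2l// normr_gt0. Qed.

Let far_line_coord b v : v != 0 -> far (b, v) -> line_coord b v != 0.
Proof.
move=> v0; apply: contraPneq => y0; apply/negP.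
rewrite /far /a /c /= y0 !linear0 normr0 addr0 -ltNge normr_gt0.
by apply: contra_neq v0; exact: hprod_eq0 y0.
Qed.

(* The projection to infinity along the central line is [h] below. *)
Lemma chain_transitive_inf_preimage Z : chain_transitive F1 Z ->
  (forall q, Z q -> (prep q.2).2 = 0) -> chain_transitive F0 (inf_embed @^-1` Z).
Proof.
move=> tZ Z2 x y Zx Zy eps T e0 T0.
(* A default for [mkproj], not reached at nonzero vectors of [far]. *)
pose d0 := x.2.
pose G (z : B * hprod H) := (z.1, mkproj d0 (line_coord z.1 z.2)).
have GZ b v k : k != 0 -> G (b, k *: v) = G (b, v).
  by move=> k0; rewrite /G/= line_coordZ mkprojZ.
have Gc b v : v != 0 -> far (b, v) -> {for (b, v), continuous G}.
  move=> v0 hv; apply: continuous_at_pair; first exact: cvg_fst.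
  apply: (@continuous_comp _ _ _ (fun z : B * hprod H => line_coord z.1 z.2)).
    exact: line_coord_continuous.
  by apply: mkproj_continuous; exact: far_line_coord.
have [d dp hd] := proj_uniform_continuous B_compact far_closed farZ GZ Gc e0.
have [d1 [T1 [d10 T10 h1]]] : exists d T, [/\ 0 < d, 0 < T & forall c,
  is_chain F1 d T c -> Z (cpt c 0%N) ->
    Z (cpt c (clen c)) -> forall i, (i <= clen c)%N ->
    far ((cpt c i).1, prep (cpt c i).2)].
  have [h|[_ //]] := lift_chain_transitive_cases tZ.
  by have := prep_neq0 (inf_embed x).2; rewrite (hprod_eq0 (h _ Zx) (Z2 _ Zx))
    eqxx.
have [||ch [cc c0 cn]] := tZ _ _ Zx Zy (Num.min d d1) (Num.max T T1).
- by rewrite lt_min dp.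
- by rewrite lt_max T0.
have cf : forall i, (i <= clen ch)%N -> far ((cpt ch i).1, prep (cpt ch i).2).
  apply: h1; rewrite ?c0 ?cn//.
  by apply: le_chain cc; [rewrite ge_min lexx orbT|rewrite le_max lexx orbT].
pose h (q : B * projspace (hprod H)) := G (q.1, prep q.2).
have hK q : h (inf_embed q) = q.
  case: q => b p; rewrite /h /inf_embed/= /inf_proj.
  have [k k0 ->] := prep_projpt (inf_neq0 (prep_neq0 p));
    rewrite GZ// /G/= /line_coord/=.
  by rewrite scale0r subr0 (mkprojE _ (prep_neq0 p)) projptK.
exists (map_chain h ch); split; last 2 first.
- by rewrite /= c0 hK.
- by rewrite /= cn hK.
split; first exact: cc.1.
move=> i ic; have [Ti bi] := cc.2 i ic.
split; first by apply: le_trans Ti; rewrite le_max lexx.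
have y0 : line_coord (cpt ch i).1 (prep (cpt ch i).2) != 0.
  by apply: far_line_coord; [exact: prep_neq0|apply: cf; exact: ltnW].
rewrite /= (_ : F0 _ _ = h (F1 (ctime ch i) (cpt ch i))).
  (* [hd] wants its first point in [far]. This is known for the points of the chain but not for
     their images under the flow, hence the exchange of the two. *)
  apply: ball_sym; apply: hd; first exact: cf.
  by apply: ball_sym; apply: le_ball bi; rewrite ge_min lexx.
rewrite /h (flow_prep GZ) /G/= line_coord_flow.
rewrite (mkprojE _ y0) (mkprojE _ (phi_neq0 _ _ y0)).
exact: (projflowE theta y0 (phi_neq0 _ _ y0) (phi_linear affine _ _)).
Qed.

(** * Chain components and Selgrade bundles of the lift *)

Hypothesis B_nonempty : [set: B] !=set0.
Hypothesis theta_ct : chain_transitive theta [set: B].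

Definition affine_embed (z : B * H) : B * projspace (hprod H) := (z.1,
  affine_pt z.2).

Lemma ball_affine_embed z eps z' : 0 < eps -> ball z (eps / 2) z' ->
  ball (affine_embed z) eps (affine_embed z').
Proof.
move=> e0 [h1 h2]; split; last exact: ball_affine_pt.
by apply: le_ball h1; rewrite ler_pdivrMr// ler_pMr// ler1n.
Qed.

Lemma affine_embed_flow t z : affine_embed (skew_flow theta psi t z) = F1 t
  (affine_embed z).
Proof.
case: z => b x; rewrite /affine_embed /skew_flow/= /affine_pt.
have v0 := affine_neq0_subproof x; have w0 := affine_lift_neq0 t b v0.
rewrite [RHS](projflowE theta (affine_neq0_subproof x) w0 (affine_lift_linear t
  b)).
congr pair; apply: (@projpt_eq _ _ _ _ _ _ 1).
by rewrite scale1r /affine_lift/= scale1r -(psiE affine).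
Qed.

Lemma affine_embed_continuous : continuous affine_embed.
Proof.
move=> z A /nbhs_ballP[eps /= e0 eA]; apply/nbhs_ballP; exists (eps / 2).
  by rewrite /= divr_gt0.
by move=> z' /(ball_affine_embed e0) /eA.
Qed.

Let graphE (b : B) : B * H := (b, E b).

Let graphE_continuous : continuous graphE.
Proof. by move=> b; apply: continuous_at_pair;
  [exact: cvg_id|exact: E_continuous]. Qed.

Let graphE_flow t b : graphE (theta t b) = skew_flow theta psi t (graphE b).
Proof. by rewrite /skew_flow/= E_flow. Qed.

Let graphE_uniform eps : 0 < eps ->
  exists2 d, 0 < d & forall b b', ball b d b' -> ball (graphE b) eps (graphE b').
Proof.
move=> e0; have [|d d0 hd] := @compact_heine R _ _ setT graphE B_compact _ eps e0.
  by move=> b _; exact: graphE_continuous.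
by exists d => // b b'; exact: hd.
Qed.

Lemma chain_transitive_graph : chain_transitive (skew_flow theta psi) (range
  graphE).
Proof. exact: chain_transitive_image graphE_flow graphE_uniform theta_ct. Qed.

Definition central_section : set (B * projspace (hprod H)) :=
  affine_embed @` range graphE.

Lemma chain_transitive_center : chain_transitive F1 central_section.
Proof.
apply: chain_transitive_image affine_embed_flow _ chain_transitive_graph =>
  eps e0.
by exists (eps / 2); [rewrite divr_gt0|move=> x y; exact: ball_affine_embed].
Qed.

Lemma central_sectionP q : central_section q <-> line_coord q.1 (prep q.2) = 0.
Proof.
split=> [[_ [b _ <-] <-] /=|].
  rewrite /affine_pt; have [k k0 ->] := prep_projpt (affine_neq0_subproof (E b)).
  by rewrite line_coordZ /line_coord/= scale1r subrr scaler0.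
case: q => b p /= h; exists (b, E b) => //; rewrite /affine_embed/=; congr pair.
rewrite -[RHS](projptK (prep_neq0 p)); apply: (@projpt_eq _ _ _ _ _ _ (prep p).2).
move: h; rewrite /line_coord => /eqP; rewrite subr_eq0 => /eqP h.
by rewrite [LHS]surjective_pairing h; congr pair; rewrite /= -[RHS]/(_ * _) mulr1.
Qed.

(** A chain recurrent point forms a chain transitive singleton. Its image under [affine_embed] is
    not at infinity, so it lies on the central line. *)
Lemma chain_recurrent_setE : chain_recurrent_set (skew_flow theta psi) = range
  graphE.
Proof.
apply/seteqP; split=> [z zR|z gz]; last first.
  by move=> eps T; exact: chain_transitive_graph.
have tz : chain_transitive F1 (affine_embed @` [set z]).
  apply: chain_transitive_image affine_embed_flow _ _ => [eps e0|].
    by exists (eps / 2); [rewrite divr_gt0|move=> x y; exact: ball_affine_embed].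
  by move=> _ _ -> -> eps T; exact: zR.
case: z zR tz => b x _ tz.
have zz : (affine_embed @` [set (b, x)]) (affine_embed (b, x)) by exists (b, x).
have [k k0 kE] := prep_projpt (affine_neq0_subproof x).
have [/(_ _ zz)|[/(_ _ zz) + _]] := lift_chain_transitive_cases tz;
  rewrite /= /affine_pt kE.
  rewrite line_coordZ => /eqP; rewrite scaler_eq0 (negPf k0) /= /line_coord/=
    scale1r subr_eq0.
  by move=> /eqP ->; exists b.
by move=> /= /eqP; rewrite -[_ *: _]/(_ * _) mulr1 (negPf k0).
Qed.

(** Maximality carries over because a chain transitive superset falls into the same case: containing
    a point at infinity, or one of the central section, it lies entirely at infinity, or entirely in
    that section. *)
Lemma lift_chain_componentP M : chain_component F1 M <->
  (exists2 M0, chain_component F0 M0 & M = inf_embed @` M0) \/ M =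
    central_section.
Proof.
have center_inf q : central_section q -> (prep q.2).2 = 0 -> False.
  move=> /central_sectionP h1 h2; have := prep_neq0 q.2.
  by rewrite (hprod_eq0 h1 h2) eqxx.
have inf_image (Z : set (B * projspace (hprod H))) : (forall q, Z q ->
  (prep q.2).2 = 0) -> inf_embed @` (inf_embed @^-1` Z) = Z.
  move=> hZ; apply/seteqP; split=> [_ [q Zq <-] //|q Zq].
  by have [q' _ q'E] := (inf_embedP q).2 (hZ q Zq); exists q' => //;
    rewrite /= q'E.
have inf_preimage (Z : set (B * projspace H)) :
  inf_embed @^-1` (inf_embed @` Z) = Z.
  by apply/seteqP; split=> [q [q' Zq' /inf_embed_inj <-] //|q Zq]; exists q.
have center_neq0 : central_section !=set0.
  by have [b _] := B_nonempty; exists (affine_embed (b, E b)), (b, E b) => //;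
    exists b.
split=> [[Mn Mt Mm]|[[M0 [[q0 M0q0] M0t M0m] ->]|->]].
- have [hM|[hM _]] := lift_chain_transitive_cases Mt.
    right; apply/esym/Mm; first exact: chain_transitive_center.
    by move=> q /hM; exact: (central_sectionP q).2.
  left; exists (inf_embed @^-1` M); last by rewrite inf_image.
  split.
  + have [q Mq] := Mn; have [q' _ q'E] := (inf_embedP q).2 (hM q Mq).
    by exists q'; rewrite /= q'E.
  + exact: chain_transitive_inf_preimage.
  + move=> Z Zt MZ; rewrite -(inf_preimage Z); congr (_ @^-1` _); apply: Mm.
      exact: chain_transitive_inf_embed.
    by rewrite -(inf_image M)//; exact: image_subset.
- split; first by exists (inf_embed q0), q0.
    exact: chain_transitive_inf_embed.
  move=> Z Zt MZ; have Zq0 : Z (inf_embed q0) by apply: MZ; exists q0.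
  have [hZ|[hZ _]] := lift_chain_transitive_cases Zt.
    by case: (center_inf (inf_embed q0)); [apply/central_sectionP;
      exact: hZ|apply/inf_embedP; exists q0].
  rewrite -(inf_image Z hZ); congr (_ @` _); apply: M0m.
    exact: chain_transitive_inf_preimage.
  by move=> q M0q; apply: MZ; exists q.
- split => //; first exact: chain_transitive_center.
  move=> Z Zt CZ; have [hZ|[hZ _]] := lift_chain_transitive_cases Zt.
    by apply/seteqP; split => // q /hZ; exact: (central_sectionP q).2.
  by have [q Cq] := center_neq0; case: (center_inf q Cq); apply: hZ; exact: CZ.
Qed.

Definition cone_of (H' : fdHilbertType R) (M : set (B * projspace H')) :
  set (B * H') :=
  [set v | forall x0 : v.2 != 0, M (v.1, projpt x0)].

Lemma at_infinity_cone M0 : at_infinity (cone_of M0) = cone_of (inf_embed @` M0).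
Proof.
apply/seteqP; split=> -[b [x q]] /=.
  rewrite /at_infinity /cone_of/= => -[hx q0] v0.
  have x0 : x != 0 by apply: contra_neq v0 => ->; rewrite q0.
  exists (b, projpt x0); first exact: hx.
  rewrite /inf_embed/= inf_projE; congr pair.
  by apply: (@projpt_eq _ _ _ _ _ _ 1); rewrite scale1r q0.
rewrite /at_infinity /cone_of/= => h.
have [v0|v0] := eqVneq ((x, q) : hprod H) 0.
  by case: v0 => -> ->; split => // x0; case/eqP: x0.
have [q' Mq' q'E] := h v0.
have : (prep (projpt v0)).2 = 0 by apply/(inf_embedP (b, projpt v0)); exists q'.
have [k k0 ->] := prep_projpt v0.
move=> /= /eqP; rewrite -[_ *: _]/(_ * _) mulf_eq0 (negPf k0) /= => /eqP q0.
split => // x0; suff <- : q' = (b, projpt x0) by [].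
apply: inf_embed_inj; rewrite q'E /inf_embed/= inf_projE; congr pair.
by apply: (@projpt_eq _ _ _ _ _ _ 1); rewrite scale1r q0.
Qed.

Definition central_line : set (B * hprod H) := [set v | line_coord v.1 v.2 = 0].

Lemma cone_center : cone_of central_section = central_line.
Proof.
apply/seteqP; split=> -[b v]; rewrite /cone_of /central_line/= => h.
  have [->|v0] := eqVneq v 0; first by rewrite /line_coord/= scale0r subr0.
  have /central_sectionP/= := h v0; have [k k0 ->] := prep_projpt v0.
  by rewrite line_coordZ => /eqP; rewrite scaler_eq0 (negPf k0) => /eqP.
move=> v0; apply/central_sectionP => /=; have [k k0 ->] := prep_projpt v0.
by rewrite line_coordZ h scaler0.
Qed.

Lemma proj_bundle_central_line : proj_bundle central_line = central_section.
Proof.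
apply/seteqP; split=> -[b p].
  move=> [x [x0 [/= h ->]]]; apply/central_sectionP => /=; have [k k0 ->] :=
    prep_projpt x0.
  by rewrite line_coordZ h scaler0.
move=> /central_sectionP/= h; exists (prep p), (prep_neq0 p); split => //=.
by rewrite projptK.
Qed.

Lemma selgrade_liftP W : selgrade_bundle theta phi1 W <->
  (exists2 W0, selgrade_bundle theta phi W0 &
    W = at_infinity W0) \/ W = central_line.
Proof.
split=> [[M /lift_chain_componentP[[M0 hM0 ->]|->] WE]|[[W0 [M0 hM0 W0E] WE]|->]].
- left; exists (cone_of M0); first by exists M0.
  by rewrite at_infinity_cone.
- by right; rewrite WE -cone_center.
- exists (inf_embed @` M0); first by apply/lift_chain_componentP; left; exists M0.
  by rewrite WE W0E -[RHS]at_infinity_cone.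
- by exists central_section; [apply/lift_chain_componentP;
  right|rewrite -cone_center].
Qed.

Lemma central_bundleP W : central_bundle theta phi f W <-> W = central_line.
Proof.
split=> [[/selgrade_liftP[[W0 _ ->] [v [[_ v2] /eqP//]]|//]]|->].
split; first by apply/selgrade_liftP; right.
have [b _] := B_nonempty; exists (b, (E b, 1)); split; last exact: oner_neq0.
by rewrite /central_line /line_coord/= scale1r subrr.
Qed.

Lemma subbundle_central_line : subbundle 1 central_line.
Proof.
split.
  rewrite (_ : central_line = [set z | `|line_coord z.1 z.2| = 0]); last first.
    apply/seteqP; split => z; rewrite /central_line/=; last exact: normr0_eq0.
    by move=> ->; rewrite normr0.
  exact/closed_eq_continuous/continuous_norm/line_coord_continuous.
exists (fun b => <[((E b, 1) : hprod H)]>%VS) => [b|].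
  by rewrite dim_vline affine_neq0_subproof.
apply/seteqP; split=> -[b [x q]]; rewrite /bundle_of /central_line/line_coord/=.
  move=> /eqP; rewrite subr_eq0 => /eqP ->; apply/vlineP; exists q.
  by congr pair; rewrite /= -[RHS]/(_ * _) mulr1.
move=> /vlineP[k [-> ->]]; rewrite -[X in _ - X *: _]/(k * 1) mulr1 subrr//.
Qed.

Lemma compact_center : compact central_section.
Proof.
rewrite /central_section; apply: continuous_compact.
  by apply: continuous_subspaceT; exact: affine_embed_continuous.
by apply: continuous_compact => //; apply: continuous_subspaceT;
  exact: graphE_continuous.
Qed.

Lemma center_proj11 : central_section `<=` [set q | proj11 q.2].
Proof.
by move=> _ [_ [b _ <-] <-]; exists (E b, 1), (affine_neq0_subproof (E b));
  split => //=; exact: oner_neq0.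
Qed.

(** * Morse spectra *)

Lemma ln_norm_scale (V : normedModType R) (k : R) (x : V) : k != 0 -> x != 0 ->
  ln `|k *: x| = ln `|k| + ln `|x|.
Proof. by move=> k0 x0; rewrite normrZ lnM// posrE normr_gt0. Qed.

(** The factor between the two representatives cancels in the difference of logarithms, and [(x, 0)]
    has the norm of [x]. *)
Let inf_exponent_term t b p :
  ln `|phi1 t b (prep (inf_proj p))| - ln `|prep (inf_proj p)| =
  ln `|phi t b (prep p)| - ln `|prep p|.
Proof.
rewrite /inf_proj; have x0 := prep_neq0 p.
have [k k0 ->] := prep_projpt (inf_neq0 (prep_neq0 p)).
rewrite -[phi1 t b]/(linear_of (affine_lift_linear t b) : hprod H ->
  hprod H) linearZ.
rewrite -[X in ln `|_ *: X|]/(phi1 t b (prep p, 0)).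
have -> : phi1 t b (prep p, 0) = (phi t b (prep p), 0).
  by rewrite /affine_lift/= scale0r addr0.
rewrite !ln_norm_scale ?inf_neq0// ?phi_neq0// !hprod_norm_fst0.
by rewrite opprD addrACA subrr add0r.
Qed.

Lemma chain_exponent_inf c0 (c1 : chain R (B * projspace (hprod H))) :
  clen c1 = clen c0 -> (forall i, (i < clen c0)%N -> ctime c1 i = ctime c0 i /\
    cpt c1 i = inf_embed (cpt c0 i)) ->
  chain_exponent phi1 c1 = chain_exponent phi c0.
Proof.
move=> nE h; rewrite /chain_exponent nE; congr (_ / _); apply: eq_bigr => i _.
  by have [-> ->] := h i (ltn_ord i); exact: inf_exponent_term.
by have [] := h i (ltn_ord i).
Qed.

Lemma proj_bundle_at_infinity W : proj_bundle (at_infinity W) = inf_embed @`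
  proj_bundle W.
Proof.
apply/seteqP; split=> [[b p] [[x q] [v0 [[/= Wx q0] pE]]]|_ [[b p] [x [x0 [/=
  Wx ->]]] <-]].
  have x0 : x != 0 by apply/eqP => xx; have /eqP[] := v0; rewrite xx q0.
  exists (b, projpt x0); first by exists x, x0.
  rewrite /inf_embed/= inf_projE pE; congr pair.
  by apply: (@projpt_eq _ _ _ _ _ _ 1); rewrite scale1r q0.
exists (x, 0), (inf_neq0 x0); split => //=.
by rewrite /inf_embed/= inf_projE.
Qed.

(** The chains that define the spectrum stay inside the bundle, so the isometric embedding
    [inf_embed] transfers them in both directions with the same [eps] and [T]. *)
Lemma morse_spectrum_at_infinity W :
  morse_spectrum theta phi1 (at_infinity W) = morse_spectrum theta phi W.
Proof.
apply/seteqP; split=> l [eps [T [ze [e0T0 el Tl hz hl]]]]; last first.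
  exists eps, T, (fun k => map_chain inf_embed (ze k)); split => //.
    move=> k; have [cc ck] := hz k; split.
      by apply: map_chain_is_chain inf_embed_flow _ cc => x y /ball_inf_embed.
    by move=> i /ck h; rewrite proj_bundle_at_infinity; exists (cpt (ze k) i).
  apply: cvg_trans hl; apply: near_eq_cvg; apply: nearW => k.
  by apply/esym/chain_exponent_inf.
(* The initial point of the first chain supplies the default for [mkproj]. *)
have [_ p0] := hz 0%N; move: (p0 0%N isT); rewrite proj_bundle_at_infinity =>
  -[[_ d0] _ _].
pose g (q : B * projspace (hprod H)) := (q.1, mkproj d0 (prep q.2).1).
have gK q : proj_bundle (at_infinity W) q ->
  inf_embed (g q) = q /\ proj_bundle W (g q).
  rewrite proj_bundle_at_infinity => -[[b p] Wp <-].
  suff -> : g (inf_embed (b, p)) = (b, p) by [].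
  rewrite /g /inf_embed/= /inf_proj; have [k k0 ->] :=
    prep_projpt (inf_neq0 (prep_neq0 p)).
  by rewrite /= mkprojZ// (mkprojE _ (prep_neq0 p)) projptK.
exists eps, T, (fun k => map_chain g (ze k)); split => //.
  move=> k; have [[n0 cc] ck] := hz k; split; last by move=> i /ck/gK[].
  split => // i ic; have [Ti bi] := cc i ic; split => //=.
  apply/ball_inf_embed; rewrite inf_embed_flow.
  by have [-> _] := gK _ (ck i (ltnW ic)); have [-> _] := gK _ (ck i.+1 ic).
apply: cvg_trans hl; apply: near_eq_cvg; apply: nearW => k.
apply: chain_exponent_inf => // i ic; split => //=.
by have [_ ck] := hz k; have [-> _] := gK _ (ck i (ltnW ic)).
Qed.

(** The lift sends [(E b, 1)] to [(E (theta t b), 1)], and these vectors have norms between 1 and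
    [1 + D]. A step therefore adds at most [ln (1 + D)] in absolute value to the numerator, however
    long it lasts, and at least [T] to the denominator. *)
Let center_exponent_bound : exists2 L : R, 0 <= L & forall eps T c, 0 < T ->
  is_chain F1 eps T c -> (forall i, (i <= clen c)%N ->
    central_section (cpt c i)) ->
  `|chain_exponent phi1 c| <= L / T.
Proof.
have : compact (E @` [set: B]).
  by apply: continuous_compact => //; apply: continuous_subspaceT.
move=> /compact_bounded[C [_ hC]]; pose D := `|C| + 1.
have D0 : 0 <= D by rewrite addr_ge0.
have ED b : `|E b| <= D by apply: hC; [rewrite (le_lt_trans (ler_norm _))//
  ltrDl|exists b].
have nE b : 1 <= `|((E b, 1) : hprod H)| <= 1 + D.
  apply/andP; split; first by have := hprod_snd_le ((E b, 1) : hprod H);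
    rewrite normr1.
  by apply: le_trans (hprod_norm_le _) _; rewrite /= normr1 addrC lerD2l.
have lE b : 0 <= ln `|((E b, 1) : hprod H)| <= ln (1 + D).
  have /andP[n1 nD] := nE b.
  by rewrite ln_ge0//= ler_ln// posrE (lt_le_trans ltr01)// (le_trans n1).
have L0 : 0 <= ln (1 + D) by rewrite ln_ge0// lerDl.
exists (ln (1 + D)) => // eps T ch T0 [n0 cc] ck; rewrite /chain_exponent.
have tau : (clen ch)%:R * T <= \sum_(i < clen ch) ctime ch i.
  have -> : (clen ch)%:R * T = \sum_(i < clen ch) T by rewrite sumr_const
    card_ord mulr_natl.
  by apply: ler_sum => i _; have [] := cc i (ltn_ord i).
have nT0 : 0 < (clen ch)%:R * T by rewrite mulr_gt0// ltr0n.
have tau0 := lt_le_trans nT0 tau.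
rewrite normrM normfV (gtr0_norm tau0) ler_pdivrMr//.
apply: le_trans (_ : (clen ch)%:R * ln (1 + D) <= _); last first.
  apply: le_trans (_ : ln (1 + D) / T * ((clen ch)%:R * T) <= _); last first.
    by rewrite ler_wpM2l// divr_ge0// ltW.
  by rewrite [X in _ <= _ * X]mulrC mulrA divfK ?gt_eqF// mulrC.
apply: le_trans (ler_norm_sum _ _ _) _.
have -> : (clen ch)%:R * ln (1 + D) = \sum_(i < clen ch) ln (1 + D).
  by rewrite sumr_const card_ord mulr_natl.
apply: ler_sum => i _; have [_ [b _ <-] <-] := ck i (ltnW (ltn_ord i)).
rewrite /affine_embed/= /affine_pt; have [k k0 ->] :=
  prep_projpt (affine_neq0_subproof (E b)).
set t := ctime ch i.
rewrite -[phi1 t b]/(linear_of (affine_lift_linear t b) : hprod H ->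
  hprod H) linearZ.
rewrite -[X in ln `|_ *: X|]/(phi1 t b (E b, 1)).
have -> : phi1 t b (E b, 1) = (E (theta t b), 1).
  by rewrite /affine_lift/= scale1r -(psiE affine) E_flow.
rewrite !ln_norm_scale ?affine_neq0_subproof// opprD addrACA subrr add0r.
have /andP[h1 h2] := lE b; have /andP[h3 h4] := lE (theta t b).
by rewrite ler_norml; lra.
Qed.

Lemma morse_spectrum_center : morse_spectrum theta phi1 central_line = [set 0].
Proof.
have [L L0 hL] := center_exponent_bound.
have LT0 (T : R^nat) : T @ \oo --> +oo -> (fun k => L / T k) @ \oo --> (0 : R).
  move=> Tl; rewrite -(mulr0 L); apply: cvgM; first exact: cvg_cst.
  by apply/gtr0_cvgV0 => //; exact: (cvgryPgt T).1 Tl 0.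
have exp0 (x T : R^nat) : T @ \oo --> +oo -> (forall k, `|x k| <= L / T k) ->
    x @ \oo --> (0 : R).
  move=> Tl xT; apply: norm_cvg0.
  by apply: (@squeeze_cvgr _ _ _ _ (fun=> 0) (fun k => L / T k)); [
    apply: nearW => k; rewrite normr_ge0 xT|exact: cvg_cst|exact: LT0].
apply/seteqP; split=> [l [eps [T [ze [e0T0 el Tl hz hl]]]]|_ ->].
  have h0 : (fun k => chain_exponent phi1 (ze k)) @ \oo --> (0 : R).
    apply: exp0 Tl _ => k; have [cc ck] := hz k.
    apply: hL cc _; first by have [] := e0T0 k.
    by move=> i /ck; rewrite proj_bundle_central_line.
  exact: cvg_unique hl h0.
have [b _] := B_nonempty.
pose T (k : nat) : R := k.+1%:R; pose eps (k : nat) : R := k.+1%:R^-1.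
(* The value 0 is attained along closed chains of the base, lifted by the section. *)
have hch k : exists c, is_chain F1 (eps k) (T k) c /\
    forall i, (i <= clen c)%N -> central_section (cpt c i).
  have e0 : 0 < eps k by rewrite invr_gt0 ltr0n.
  have [d d0 hd] := graphE_uniform (divr_gt0 e0 (ltr0n _ 2)).
  have T0 : 0 < T k by rewrite ltr0n.
  have [c0 [cc _ _]] := @theta_ct b b I I d (T k) d0 T0.
  exists (map_chain (affine_embed \o graphE) c0); split.
    apply: map_chain_is_chain cc => [t x|x y /hd]; last exact: ball_affine_embed.
    by rewrite /comp graphE_flow affine_embed_flow.
  by move=> i _; exists (graphE (cpt c0 i)) => //; exists (cpt c0 i).
have [ze hze] := choice hch.
have Tl : T @ \oo --> +oo.
  by rewrite /T (cvg_shiftS (fun n => n%:R : R)); exact: cvgr_idn.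
exists eps, T, ze; split => //.
- by move=> k; rewrite invr_gt0 !ltr0n.
- exact: cvg_harmonic.
- by move=> k; have [h1 h2] := hze k; split => // i /h2;
  rewrite proj_bundle_central_line.
- apply: exp0 Tl _ => k; have [h1 h2] := hze k; apply: hL h1 h2.
  by rewrite ltr0n.
Qed.

End lifted_flow.

Theorem theorem26 (R : realType) (B : metricType R) (H : fdHilbertType R)
  (B_nonempty : [set: B] !=set0) (B_compact : compact [set: B])
  (theta : R -> B -> B) (theta_flow : is_flow theta)
  (theta_ct : chain_transitive theta [set: B])
  (phi psi : R -> B -> H -> H) (f : B -> R -> H)
  (affine : is_affine_flow theta phi f psi)
  (hyperbolic : uniformly_hyperbolic theta phi f)
  (e : B -> R -> H) (e_bounded : forall b, bounded_solution psi b (e b))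
  (l : nat) (V : 'I_l -> set (B * H))
  (V_selgrade : set_bij [set: 'I_l] [set W | selgrade_bundle theta phi W] V) :
  let phi1 := affine_lift theta phi f in
  let Vc := bounded_line e in
  let Mc := proj_bundle Vc in
  [/\ [/\ (forall W, selgrade_bundle theta phi1 W <->
             (exists i, W = at_infinity (V i)) \/ central_bundle theta phi f W),
          (forall W, central_bundle theta phi f W <-> W = Vc),
          subbundle 1 Vc &
          [/\ compact Mc,
              Mc `<=` [set q | proj11 q.2],
              Mc = [set (v.1, affine_pt v.2)
                     | v in chain_recurrent_set (skew_flow theta psi)],
              chain_recurrent_set (skew_flow theta psi)
                = h_aff e @^-1` zero_section &
              h_aff e @^-1` zero_section = [set (b, e b 0) | b in [set: B]]]],
      (forall i, morse_spectrum theta phi1 (at_infinity (V i))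
         = morse_spectrum theta phi (V i)) &
      morse_spectrum theta phi1 Vc = [set 0]].
Proof.
move=> phi1 Vc Mc.
have [U1 [U2 [[k1 [k2 [[c1 _] [c2 _]]]] U12 invU [al [K [al0 K0 st un]]] _]]]
  := hyperbolic.
pose E b := e b 0.
have Ec : continuous E.
  exact: (bounded_section_continuous B_compact theta_flow affine c1 c2 U12 invU
    al0 K0 st un e_bounded).
have Ef t b : psi t b (E b) = E (theta t b).
  exact: (bounded_section_flow B_compact theta_flow affine c1 c2 U12 invU al0
    K0 st un e_bounded).
have VcE : Vc = central_line E.
  apply/seteqP; split=> [_ [[b r] _ <-]|[b [x r]]];
    rewrite /central_line /line_coord/=.
    by rewrite subrr.
  by move=> /eqP; rewrite subr_eq0 => /eqP ->; exists (b, r).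
have McE : Mc = central_section E by rewrite /Mc VcE;
  exact: proj_bundle_central_line.
have Vs W : selgrade_bundle theta phi W <-> exists i, W = V i.
  have [Vf _ Vsurj] := V_selgrade.
  by split=> [/Vsurj[i _ <-]|[i ->]]; [exists i|exact: Vf].
have sel W := selgrade_liftP B_compact affine c1 c2 U12 invU al0 K0 st un Ec Ef
  B_nonempty theta_ct W.
have cen W := central_bundleP B_compact affine c1 c2 U12 invU al0 K0 st un Ec
  Ef B_nonempty theta_ct W.
have CR := chain_recurrent_setE B_compact affine c1 c2 U12 invU al0 K0 st un Ec
  Ef theta_ct.
have zE : h_aff e @^-1` zero_section = [set (b, e b 0) | b in [set: B]].
  apply/seteqP; split=> [[b x]|_ [b _ <-]]; rewrite /h_aff /zero_section/=.
    by move=> /eqP; rewrite subr_eq0 => /eqP ->; exists b.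
  by rewrite subrr.
split; last 2 first.
- by move=> i; exact: (morse_spectrum_at_infinity affine).
- by rewrite VcE; exact: (morse_spectrum_center B_compact affine Ec Ef
  B_nonempty theta_ct).
split.
- move=> W; split=> [/sel[[W0 /Vs[i ->] ->]|WE]|[[i ->]|[]//]].
  + by left; exists i.
  + by right; apply/cen.
  + by apply/sel; left; exists (V i) => //; apply/Vs; exists i.
- by move=> W; rewrite VcE; exact: cen.
- by rewrite VcE; exact: subbundle_central_line.
- split.
  + by rewrite McE; exact: compact_center.
  + by rewrite McE; exact: center_proj11.
  + by rewrite McE CR.
  + by rewrite CR zE.
  + exact: zE.
Qed.
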